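(* Suppose that $\mathcal{X}=((X_n)_{n\in\omega},(\phi_n)_{n\in\omega})$ is a vast inverse system of permutative LD-systems. (1) $\mathrm{EE}(\mathcal{X})$ is a dense $G_\delta$ subset of $\varprojlim_{n\in\omega}X_n$, and $\mathrm{EE}(\mathcal{X})^+$ is a dense open subset of $\mathrm{EE}(\mathcal{X})$. (2) $\mathrm{EE}(\mathcal{X})$ and $\mathrm{EE}(\mathcal{X})^+$ are closed under $*$. If each $X_n$ is reduced, then $\mathrm{EE}(\mathcal{X})$ and $\mathrm{EE}(\mathcal{X})^+$ are closed under $\circ$. (3) $(\mathrm{EE}(\mathcal{X})^+,* )$ is an acyclic LD-system. (4) Every element of $\mathrm{EE}(\mathcal{X})^+$ freely generates a sub-LD-system of $(\mathrm{EE}(\mathcal{X})^+,* )$. Furthermore, if $\mathcal{X}$ is a vast system of permutative LD-monoids, then every element of $\mathrm{EE}(\mathcal{X})\setminus\{1\}$ freely generates a sub-LD-monoid of $(\mathrm{EE}(\mathcal{X}),*,\circ,1)$.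
   Context: LD-system: a set with a binary operation satisfying $x*(y*z)=(x*y)*(x*z)$. $\mathrm{Li}(X)$ is the set of $x\in X$ with $x*y=y$ for all $y$. $X$ is permutative if $\mathrm{Li}(X)$ is a left-ideal ($y\in\mathrm{Li}(X)$ implies $x*y\in\mathrm{Li}(X)$ for all $x$) and for all $x,y$ there is $k\ge1$ with $t_k(x,y)\in\mathrm{Li}(X)$, where $t_1(x,y)=y$, $t_2(x,y)=x$, $t_{k+2}(x,y)=t_{k+1}(x,y)*t_k(x,y)$. $X$ is reduced if $\mathrm{Li}(X)=\{1\}$ is a singleton; then there is a unique operation $\circ$ with $x\circ y=(x*y)\circ x$, $x\circ1=x$, and $(X,*,\circ,1)$ is an LD-monoid, called a permutative LD-monoid. LD-monoid: $(X,\circ,1)$ is a monoid and $(x\circ y)*z=x*(y*z)$, $x*(y\circ z)=(x*y)\circ(x*z)$, $x\circ y=(x*y)\circ x$, $1*x=x$, $x*1=1$. Critical points in a permutative $X$: $\mathrm{crit}(x)\le\mathrm{crit}(y)$ means $x^k*y\in\mathrm{Li}(X)$ for some $k\ge0$, where $x^0*y=y$, $x^{k+1}*y=x*(x^k*y)$; $\mathrm{crit}(x)$ is the class of $x$ under the induced equivalence; $\mathrm{crit}[X]$ is the set of these, linearly ordered with a greatest element; $x^\sharp(\mathrm{crit}(r))=\mathrm{crit}(x*r)$. For $\alpha\in\mathrm{crit}[X]$, $x\equiv^\alpha y$ iff $r*x=r*y$ for any (equivalently some) $r$ with $\mathrm{crit}(r)=\alpha$ and $r*r\in\mathrm{Li}(X)$;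 it is a congruence. Vast: an inverse system of permutative LD-systems with transition homomorphisms $\phi_n:X_{n+1}\to X_n$ (and composites $\phi_{m,n}:X_m\to X_n$) is vast if (i) for each $n$ there is $\alpha_n\in\mathrm{crit}[X_{n+1}]$ such that the kernel of $\phi_n$ is $\equiv^{\alpha_n}$, and (ii) for all $n$ and $x,y\in X_n$ there are $m\ge n$ and $x',y'\in X_m$ with $\phi_{m,n}(x')=x$, $\phi_{m,n}(y')=y$ and $x'*y'\notin\mathrm{Li}(X_m)$. A vast system of permutative LD-monoids is a vast system in which every $X_n$ is a permutative LD-monoid. Convention: $\mathrm{crit}[X_n]$ is identified with an initial segment of $\mathrm{crit}[X_{n+1}]$ so that $\mathrm{crit}(\phi_n(x))=\mathrm{crit}(x)$ whenever $\phi_n(x)\notin\mathrm{Li}(X_n)$ (and $\max\mathrm{crit}[X_n]=\alpha_n$); $\mathrm{crit}[\mathcal{X}]=\bigcup_n\mathrm{crit}[X_n]$. $\mathrm{EE}(\mathcal{X})$ is the set of threads $(x_n)_n\in\varprojlim X_n$ such that for all $\alpha\in\mathrm{crit}[\mathcal{X}]$ there is $m$ with $\alpha\in\mathrm{crit}[X_m]$ and $x_m^\sharp(\alpha)<\max(\mathrm{crit}[X_m])$. $\mathrm{EE}(\mathcal{X})^+$ is the set of $(x_n)_n\in\mathrm{EE}(\mathcal{X})$ with $x_n\notin\mathrm{Li}(X_n)$ for some $n$. Each $X_n$ is discrete and $\varprojlim X_n$ has the inverse limit topology; operations are coordinatewise. An LD-system is acyclic if there are no $n\ge1$ and $x,x_1,\dots,x_n$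 with $(\cdots((x*x_1)*x_2)\cdots)*x_n=x$. An element $x$ freely generates a sub-LD-system (sub-LD-monoid) if the homomorphism from the free LD-system (LD-monoid) on one generator sending the generator to $x$ is injective. *)

(* Defs.v *)
From HB Require Import structures.
From mathcomp Require Import all_boot generic_quotient.
From mathcomp Require Import all_classical all_reals all_analysis.

Set Implicit Arguments.
Unset Strict Implicit.
Unset Printing Implicit Defensive.

Local Open Scope classical_set_scope.
Local Open Scope quotient_scope.

(* x * (y * z) = (x * y) * (x * z) *)
Definition LD_system (T : Type) (op : T -> T -> T) := right_distributive op op.

Section Permutative.
Context {T : Type} (op : T -> T -> T).
Local Notation "x * y" := (op x y).

Definition Li : set T := [set x | forall y, x * y = y].

(* [tseq x y k] is t_{k+1}(x, y): indices are shifted so that they start at 0. *)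
Fixpoint tseq (x y : T) (k : nat) : T :=
  match k with
  | 0 => y
  | 1 => x
  | (k''.+1 as k').+1 => tseq x y k' * tseq x y k''
  end.

Record permutative : Prop := Permutative {
  permutative_LD : LD_system op;
  permutative_ideal : forall x y, Li y -> Li (x * y);
  permutative_tseq : forall x y, exists k, Li (tseq x y k) }.

(* The relation crit(x) <= crit(y) between elements. *)
Definition crit_le (x y : T) : Prop := exists k, Li (iter k (op x) y).

(* Critical points are encoded as equivalence classes, i.e. as subsets of T. *)
Definition crit (x : T) : set T := [set y | crit_le x y /\ crit_le y x].

Definition crits : set (set T) := range crit.

Definition critc_le (a b : set T) : Prop :=
  exists x y, [/\ a = crit x, b = crit y & crit_le x y].

Definition critc_lt (a b : set T) : Prop := critc_le a b /\ a <> b.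

(* The greatest critical point: the class of all z such that
   crit(y) <= crit(z) for every y. *)
Definition crit_max : set T := [set z | forall y, crit_le y z].

(* The map crit(r) |-> crit(x * r).  All the members of the union coincide
   when [a] is a critical point of a permutative LD-system. *)
Definition sharp (x : T) (a : set T) : set T := \bigcup_(r in a) crit (x * r).

Definition crit_equiv (a : set T) (x y : T) : Prop :=
  exists r, [/\ crit r = a, Li (r * r) & r * x = r * y].

(* The defining equations of the operation \circ of a reduced permutative
   LD-system with Li = {e}; see [circ_exists_unique]. *)
Definition is_circ (e : T) (circ : T -> T -> T) : Prop :=
  (forall x y, circ x y = circ (x * y) x) /\ (forall x, circ x e = x).

Record LD_monoid (circ : T -> T -> T) (e : T) : Prop := LDMonoid {
  LDm_assoc : associative circ;
  LDm_1l : left_id e circ;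
  LDm_1r : right_id e circ;
  LDm_act : forall x y z, circ x y * z = x * (y * z);
  LDm_dist : forall x y z, x * circ y z = circ (x * y) (x * z);
  LDm_comm : forall x y, circ x y = circ (x * y) x;
  LDm_act1 : forall x, e * x = x;
  LDm_fix1 : forall x, x * e = e }.

Record permutative_LD_monoid (circ : T -> T -> T) (e : T) : Prop :=
  PermutativeLDMonoid {
    pLDm_permutative : permutative;
    pLDm_reduced : Li = [set e];
    pLDm_monoid : LD_monoid circ e }.

Lemma tseqSS x y k : tseq x y k.+2 = tseq x y k.+1 * tseq x y k.
Proof. by []. Qed.

Lemma tseq_shift x y k : tseq (x * y) x k = tseq x y k.+1.
Proof.
suff [] : tseq (x * y) x k = tseq x y k.+1 /\
          tseq (x * y) x k.+1 = tseq x y k.+2 by [].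
by elim: k => [//|k [h1 h2]]; split=> //; rewrite tseqSS h1 h2.
Qed.

Lemma circ_exists_unique (e : T) :
  permutative -> Li = [set e] -> exists! circ, is_circ e circ.
Proof.
move=> [_ idl ex] Lie.
have Lie_e : Li e by rewrite Lie.
have mule x : x * e = e by have := idl x e Lie_e; rewrite {1}Lie.
have LiE x : Li x -> x = e by rewrite Lie.
have step x y k i : tseq x y k = e ->
    (tseq x y (k + i) = e /\ tseq x y (k + i).+1 = tseq x y k.+1) \/
    (tseq x y (k + i) = tseq x y k.+1 /\ tseq x y (k + i).+1 = e).
  move=> ke; elim: i => [|i [[h1 h2]|[h1 h2]]]; rewrite ?addn0 ?addnS.
  - by left.
  - by right; rewrite tseqSS h1 h2 mule.
  - by left; rewrite tseqSS h1 h2 Lie_e.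
have indep x y k l : Li (tseq x y k) -> Li (tseq x y l) ->
    tseq x y k.+1 = tseq x y l.+1.
  wlog kl : k l / (k <= l)%N.
    by move=> H; case/orP: (leq_total k l) => /H // K ? ?; apply/esym/K.
  move=> /LiE ke /LiE; rewrite -(subnKC kl).
  case: (step x y k (l - k)%N ke) => [[h1 h2] //|[h1 h2]].
  by rewrite h1 h2.
pose kk x y := projT1 (cid (ex x y)).
have kkP x y : Li (tseq x y (kk x y)) := projT2 (cid (ex x y)).
exists (fun x y => tseq x y (kk x y).+1); split; [split|].
- move=> x y; rewrite tseq_shift; apply: (indep x y) => //.
  by rewrite -tseq_shift; apply: kkP.
- by move=> x; rewrite -(indep x e 0 (kk x e)).
move=> c [c1 c2]; apply: funext => x; apply: funext => y; apply: esym.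
have H k : c x y = c (tseq x y k.+1) (tseq x y k).
  by elim: k => [//|k IH]; rewrite IH c1 -tseqSS.
by rewrite (H (kk x y)) [X in c _ X](LiE _ (kkP x y)) c2.
Qed.

End Permutative.

Section Relative.
Context {T : Type} (D : set T) (op : T -> T -> T).

Definition closed_under : Prop := forall x y, D x -> D y -> D (op x y).

Definition LD_system_on : Prop := closed_under /\
  forall x y z, D x -> D y -> D z -> op x (op y z) = op (op x y) (op x z).

(* No x, x_1, ..., x_n in D with n >= 1 and (..((x * x_1) * x_2)..) * x_n = x *)
Definition acyclic_on : Prop := forall (x : T) (s : seq T),
  x \in D -> all (fun y => y \in D) s -> s <> [::] -> foldl op x s <> x.

End Relative.

Inductive LD_term : Type := LDgen | LDapp of LD_term & LD_term.

Inductive LD_congr : LD_term -> LD_term -> Prop :=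
| LDc_refl s : LD_congr s s
| LDc_sym s t : LD_congr s t -> LD_congr t s
| LDc_trans s t u : LD_congr s t -> LD_congr t u -> LD_congr s u
| LDc_app s s' t t' :
    LD_congr s s' -> LD_congr t t' -> LD_congr (LDapp s t) (LDapp s' t')
| LDc_LD s t u :
    LD_congr (LDapp s (LDapp t u)) (LDapp (LDapp s t) (LDapp s u)).

HB.instance Definition _ := gen_eqMixin LD_term.
HB.instance Definition _ := gen_choiceMixin LD_term.

Section FreeLD.

Let R : rel LD_term := fun s t => `[< LD_congr s t >].

Lemma LD_congr_equiv : equiv_class_of R.
Proof.
split=> [s|s t|t s u]; rewrite /R.
- by apply/asboolP/LDc_refl.
- by apply/asboolP/asboolP; apply: LDc_sym.
- by move=> /asboolP h1 /asboolP h2; apply/asboolP; apply: LDc_trans h2.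
Qed.

Definition LD_congr_rel := EquivRelPack LD_congr_equiv.

(* The free LD-system on one generator. *)
Definition free_LD : Type := {eq_quot LD_congr_rel}.

Let piLD (s : LD_term) : free_LD := \pi_{eq_quot LD_congr_rel} s.

Definition free_LD_gen : free_LD := piLD LDgen.

Definition free_LD_op (a b : free_LD) : free_LD :=
  piLD (LDapp (repr (a : {eq_quot LD_congr_rel}))
              (repr (b : {eq_quot LD_congr_rel}))).

Lemma piLDP s t : piLD s = piLD t <-> LD_congr s t.
Proof.
split=> [/eqP|h]; last apply/eqP; rewrite /piLD eqmodE => /=.
  by move/asboolP.
exact/asboolP.
Qed.

Lemma free_LD_opE s t : free_LD_op (piLD s) (piLD t) = piLD (LDapp s t).
Proof. by apply/piLDP/LDc_app; apply/piLDP; rewrite /piLD reprK. Qed.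

Lemma piLD_surj a : exists s, a = piLD s.
Proof. by exists (repr (a : {eq_quot LD_congr_rel})); rewrite /piLD reprK. Qed.

Lemma free_LD_LD : LD_system free_LD_op.
Proof.
move=> a b c; have [s ->] := piLD_surj a; have [t ->] := piLD_surj b.
have [u ->] := piLD_surj c; rewrite !free_LD_opE; apply/piLDP.
exact: LDc_LD.
Qed.

Lemma free_LD_universal (T : Type) (op : T -> T -> T) (x : T) :
  LD_system op ->
  exists! f : free_LD -> T,
    {morph f : a b / free_LD_op a b >-> op a b} /\ f free_LD_gen = x.
Proof.
move=> ld.
pose ev := fix ev t := match t with LDgen => x | LDapp s t => op (ev s) (ev t) end.
have evP s t : LD_congr s t -> ev s = ev t.
  by elim=> {s t} //=; congruence.
pose f (a : free_LD) := ev (repr (a : {eq_quot LD_congr_rel})).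
have fE s : f (piLD s) = ev s by apply/evP/piLDP; rewrite /piLD reprK.
exists f; split; [split|].
- move=> a b; have [s ->] := piLD_surj a; have [t ->] := piLD_surj b.
  by rewrite free_LD_opE !fE.
- exact: fE.
move=> g [gM gx]; apply: funext => a; have [s ->] := piLD_surj a.
rewrite fE; elim: s => [//=|s IHs t IHt].
by rewrite -free_LD_opE gM -IHs -IHt.
Qed.

End FreeLD.

Inductive LDm_term : Type :=
| LDMgen | LDMone | LDMapp of LDm_term & LDm_term | LDMcirc of LDm_term & LDm_term.

Inductive LDm_congr : LDm_term -> LDm_term -> Prop :=
| LDMc_refl s : LDm_congr s s
| LDMc_sym s t : LDm_congr s t -> LDm_congr t s
| LDMc_trans s t u : LDm_congr s t -> LDm_congr t u -> LDm_congr s u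
| LDMc_app s s' t t' :
    LDm_congr s s' -> LDm_congr t t' -> LDm_congr (LDMapp s t) (LDMapp s' t')
| LDMc_circ s s' t t' :
    LDm_congr s s' -> LDm_congr t t' -> LDm_congr (LDMcirc s t) (LDMcirc s' t')
| LDMc_assoc s t u :
    LDm_congr (LDMcirc s (LDMcirc t u)) (LDMcirc (LDMcirc s t) u)
| LDMc_1l s : LDm_congr (LDMcirc LDMone s) s
| LDMc_1r s : LDm_congr (LDMcirc s LDMone) s
| LDMc_act s t u :
    LDm_congr (LDMapp (LDMcirc s t) u) (LDMapp s (LDMapp t u))
| LDMc_dist s t u :
    LDm_congr (LDMapp s (LDMcirc t u)) (LDMcirc (LDMapp s t) (LDMapp s u))
| LDMc_comm s t : LDm_congr (LDMcirc s t) (LDMcirc (LDMapp s t) s)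
| LDMc_act1 s : LDm_congr (LDMapp LDMone s) s
| LDMc_fix1 s : LDm_congr (LDMapp s LDMone) LDMone.

HB.instance Definition _ := gen_eqMixin LDm_term.
HB.instance Definition _ := gen_choiceMixin LDm_term.

Section FreeLDMonoid.

Let R : rel LDm_term := fun s t => `[< LDm_congr s t >].

Lemma LDm_congr_equiv : equiv_class_of R.
Proof.
split=> [s|s t|t s u]; rewrite /R.
- by apply/asboolP/LDMc_refl.
- by apply/asboolP/asboolP; apply: LDMc_sym.
- by move=> /asboolP h1 /asboolP h2; apply/asboolP; apply: LDMc_trans h2.
Qed.

Definition LDm_congr_rel := EquivRelPack LDm_congr_equiv.

(* The free LD-monoid on one generator. *)
Definition free_LDm : Type := {eq_quot LDm_congr_rel}.

Let piLDm (s : LDm_term) : free_LDm := \pi_{eq_quot LDm_congr_rel} s.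

Definition free_LDm_gen : free_LDm := piLDm LDMgen.

Definition free_LDm_one : free_LDm := piLDm LDMone.

Definition free_LDm_op (a b : free_LDm) : free_LDm :=
  piLDm (LDMapp (repr (a : {eq_quot LDm_congr_rel}))
                (repr (b : {eq_quot LDm_congr_rel}))).

Definition free_LDm_circ (a b : free_LDm) : free_LDm :=
  piLDm (LDMcirc (repr (a : {eq_quot LDm_congr_rel}))
                 (repr (b : {eq_quot LDm_congr_rel}))).

Lemma piLDmP s t : piLDm s = piLDm t <-> LDm_congr s t.
Proof.
split=> [/eqP|h]; last apply/eqP; rewrite /piLDm eqmodE => /=.
  by move/asboolP.
exact/asboolP.
Qed.

Lemma free_LDm_opE s t : free_LDm_op (piLDm s) (piLDm t) = piLDm (LDMapp s t).
Proof. by apply/piLDmP/LDMc_app; apply/piLDmP; rewrite /piLDm reprK. Qed.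

Lemma free_LDm_circE s t :
  free_LDm_circ (piLDm s) (piLDm t) = piLDm (LDMcirc s t).
Proof. by apply/piLDmP/LDMc_circ; apply/piLDmP; rewrite /piLDm reprK. Qed.

Lemma piLDm_surj a : exists s, a = piLDm s.
Proof. by exists (repr (a : {eq_quot LDm_congr_rel})); rewrite /piLDm reprK. Qed.

Lemma free_LDm_LD_monoid : LD_monoid free_LDm_op free_LDm_circ free_LDm_one.
Proof.
have E := (free_LDm_opE, free_LDm_circE).
split; rewrite /free_LDm_one.
- move=> a b c; have [s ->] := piLDm_surj a; have [t ->] := piLDm_surj b.
  have [u ->] := piLDm_surj c; rewrite !E; exact/piLDmP/LDMc_assoc.
- move=> a; have [s ->] := piLDm_surj a; rewrite !E; exact/piLDmP/LDMc_1l.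
- move=> a; have [s ->] := piLDm_surj a; rewrite !E; exact/piLDmP/LDMc_1r.
- move=> a b c; have [s ->] := piLDm_surj a; have [t ->] := piLDm_surj b.
  have [u ->] := piLDm_surj c; rewrite !E; exact/piLDmP/LDMc_act.
- move=> a b c; have [s ->] := piLDm_surj a; have [t ->] := piLDm_surj b.
  have [u ->] := piLDm_surj c; rewrite !E; exact/piLDmP/LDMc_dist.
- move=> a b; have [s ->] := piLDm_surj a; have [t ->] := piLDm_surj b.
  rewrite !E; exact/piLDmP/LDMc_comm.
- move=> a; have [s ->] := piLDm_surj a; rewrite !E; exact/piLDmP/LDMc_act1.
- move=> a; have [s ->] := piLDm_surj a; rewrite !E; exact/piLDmP/LDMc_fix1.
Qed.

Lemma free_LDm_universal (T : Type) (op circ : T -> T -> T) (e x : T) :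
  LD_monoid op circ e ->
  exists! f : free_LDm -> T,
    [/\ {morph f : a b / free_LDm_op a b >-> op a b},
        {morph f : a b / free_LDm_circ a b >-> circ a b},
        f free_LDm_one = e & f free_LDm_gen = x].
Proof.
move=> ldm.
pose ev := fix ev t := match t with
  | LDMgen => x | LDMone => e
  | LDMapp s t => op (ev s) (ev t) | LDMcirc s t => circ (ev s) (ev t) end.
have evP s t : LDm_congr s t -> ev s = ev t.
  case: ldm => h1 h2 h3 h4 h5 h6 h7 h8.
  by elim=> {s t} //=; congruence.
pose f (a : free_LDm) := ev (repr (a : {eq_quot LDm_congr_rel})).
have fE s : f (piLDm s) = ev s by apply/evP/piLDmP; rewrite /piLDm reprK.
exists f; split; [split|].
- move=> a b; have [s ->] := piLDm_surj a; have [t ->] := piLDm_surj b.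
  by rewrite free_LDm_opE !fE.
- move=> a b; have [s ->] := piLDm_surj a; have [t ->] := piLDm_surj b.
  by rewrite free_LDm_circE !fE.
- exact: fE.
- exact: fE.
move=> g [gM gC g1 gx]; apply: funext => a; have [s ->] := piLDm_surj a.
rewrite fE; elim: s => [//=|//=|s IHs t IHt|s IHs t IHt].
- by rewrite -free_LDm_opE gM -IHs -IHt.
- by rewrite -free_LDm_circE gC -IHs -IHt.
Qed.

End FreeLDMonoid.

(* x freely generates a sub-LD-system of (D, op). *)
Definition freely_generates_LD (T : Type) (D : set T) (op : T -> T -> T)
    (x : T) : Prop :=
  exists f : free_LD -> T,
    [/\ {morph f : a b / free_LD_op a b >-> op a b}, f free_LD_gen = x,
        (forall a, D (f a)) & injective f].

(* x freely generates a sub-LD-monoid of (D, op, circ, e). *)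
Definition freely_generates_LD_monoid (T : Type) (D : set T)
    (op circ : T -> T -> T) (e x : T) : Prop :=
  exists f : free_LDm -> T,
    [/\ {morph f : a b / free_LDm_op a b >-> op a b} /\
        {morph f : a b / free_LDm_circ a b >-> circ a b},
        f free_LDm_one = e, f free_LDm_gen = x,
        (forall a, D (f a)) & injective f].

Section InverseSystem.
Context {X : nat -> Type}.
Variable op : forall n, X n -> X n -> X n.
Variable phi : forall n, X n.+1 -> X n.

(* The composite phi_{k + n, n}. *)
Fixpoint phi_iter (n k : nat) : X (k + n) -> X n :=
  match k return X (k + n) -> X n with
  | 0 => id
  | k'.+1 => fun x => phi_iter (@phi (k' + n) x)
  end.

Definition kernel_crit (n : nat) : set (set (X n.+1)) :=
  [set a | crits (@op n.+1) a /\
           forall x y, phi x = phi y <-> crit_equiv (@op n.+1) a x y].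

Record vast : Prop := Vast {
  vast_permutative : forall n, permutative (@op n);
  vast_morph : forall n, {morph @phi n : x y / op x y >-> op x y};
  vast_kernel : forall n, exists a, @kernel_crit n a;
  vast_nontrivial : forall n (x y : X n), exists k (x' y' : X (k + n)),
    [/\ phi_iter x' = x, phi_iter y' = y & ~ Li (@op (k + n)) (op x' y')] }.

(* alpha_n: the kernel of phi_n determines it, so [get] makes no real choice. *)
Definition alpha (n : nat) : set (X n.+1) := get (@kernel_crit n).

(* The identification of crit[X_n] with an initial segment of crit[X_{n+1}]:
   the greatest element is sent to alpha_n and any other critical point a to
   crit(x), where x is such that crit(phi_n(x)) = a. *)
Definition crit_up (n : nat) (a : set (X n)) : set (X n.+1) :=
  if pselect (a = crit_max (@op n)) then @alpha n
  else \bigcup_(x in [set x | crit (@op n) (phi x) = a]) crit (@op n.+1) x.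

Definition crit_shift (u : {n & set (X n)}) : {n & set (X n)} :=
  existT (fun n => set (X n)) (projT1 u).+1 (crit_up (projT2 u)).

(* Identification of a critical point of some X_n with one of some X_m. *)
Definition crit_same (u v : {n & set (X n)}) : Prop :=
  exists i j, iter i crit_shift u = iter j crit_shift v.

(* crit[X], the union of the crit[X_n] along these identifications.  Its
   elements are the classes of pairs (n, a) with a in crit[X_n]. *)
Definition critX : set (set {n & set (X n)}) :=
  [set c | exists n a, crits (@op n) a /\ c = crit_same (existT _ n a)].

Definition thread : set (forall n, X n) := 
  [set x : forall n, X n | forall n, phi (x n.+1) = x n].

Definition EE : set (forall n, X n) := [set x : forall n, X n | thread x /\
  forall c, critX c -> exists m a,
    [/\ crits (@op m) a, c (existT _ m a)
      & critc_lt (@op m) (sharp (@op m) (x m) a) (crit_max (@op m))]].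

Definition EEplus : set (forall n, X n) :=
  [set x : forall n, X n | EE x /\ exists n, ~ Li (@op n) (x n)].

End InverseSystem.

Definition prod_op (X : nat -> Type) (op : forall n, X n -> X n -> X n)
    (x y : forall n, X n) : forall n, X n :=
  fun n => op n (x n) (y n).

Definition prodspace (X : nat -> choiceType) : topologicalType :=
  prod_topology (fun n => discrete_topology (X n)).

(* The subset B `&` A of A, where A carries the subspace topology. *)
Definition trace_on (S : topologicalType) (A B : set S) : set (set_type A) :=
  set_val @^-1` B.

(* Main.v *)
Require Import Defs.
From mathcomp Require Import all_boot.
From mathcomp Require Import all_classical all_reals all_analysis borel_hierarchy.

Local Open Scope classical_set_scope.

(* A thread x lies in EE iff for every n some thread t, trivial at level n, has
   x * t eventually nontrivial.  This reformulation, which rests on the linear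
   order of the critical points of each X_n, yields the closure properties, and
   shows that EE is a countable intersection of open sets; it is dense because
   vastness allows one to extend any finite part of a thread so that it moves one
   more critical point.

   For acyclicity, project a cycle of left divisions to a level n where none of
   its members is in Li(X_n), and let a be a member whose critical point is
   maximal.  Modulo crit(a * a), every later member of the cycle is congruent to
   an element a * u of the image of a.  Hence so is a itself when the cycle
   returns to it, but crit(a) is never of the form crit(a * u).

   Acyclicity gives freeness by comparison: two terms in one variable are
   LD-equivalent, or one is an iterated left divisor of the other.  This follows
   from the confluence of the expansion s(tu) -> (st)(su) and from the absorption
   property t * x^[n] = x^[n+1] (n large), after Dehornoy.  For monoids, a
   composition a_1 o ... o a_n is read off as the sequence of left subtrees along
   a branch of the tree a_1(a_2(...(a_n x^[N]))); expansion preserves such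
   branches up to equivalence, so any two compositions become branches of a
   common tree, where p and q are either equivalent, or one of p * x and q * x
   is an iterated left divisor of the other. *)

(** * Critical points of a permutative LD-system *)

Section PermutativeTheory.
Context {T : Type} {op : T -> T -> T}.
Hypothesis perm : permutative op.
Local Notation "x * y" := (op x y).
Local Notation "x ^[ k ] * y" := (iter k (op x) y)
  (at level 40, k at level 0, y at level 39, format "x ^[ k ] * y").
Local Notation Li := (Li op).
Local Notation tseq := (tseq op).
Local Infix "<=c" := (crit_le op) (at level 70).

Let opA x y z : x * (y * z) = (x * y) * (x * z).
Proof. exact: (permutative_LD perm). Qed.

Let LiM x y : Li y -> Li (x * y).
Proof. exact: (permutative_ideal perm). Qed.

Lemma iter_opM x y z k : x ^[k] * (y * z) = (x ^[k] * y) * (x ^[k] * z).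
Proof. by elim: k => //= k ->; exact: opA. Qed.

Lemma iter_op_iter x y z k l :
  x ^[k] * (y ^[l] * z) = (x ^[k] * y) ^[l] * (x ^[k] * z).
Proof. by elim: l => //= l IH; rewrite iter_opM IH. Qed.

Lemma op_iter x y z k : x * (y ^[k] * z) = (x * y) ^[k] * (x * z).
Proof. exact: (iter_op_iter x y z 1). Qed.

Lemma Li_iter x y k : Li y -> Li (x ^[k] * y).
Proof. by move=> Ly; elim: k => //= k; exact: LiM. Qed.

Lemma Li_iter_le x y k l : (k <= l)%N -> Li (x ^[k] * y) -> Li (x ^[l] * y).
Proof. by move=> /subnK <- ?; rewrite iterD; exact: Li_iter. Qed.

Lemma iter_Li x y k : Li x -> x ^[k] * y = y.
Proof. by move=> Lx; elim: k => //= k ->; exact: Lx. Qed.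

(** By left distributivity, the composite of the left multiplications by two consecutive terms does
    not depend on the position. *)
Lemma tseq_step2 x y j z :
  tseq x y j.+1 * (tseq x y j * z) = x * (y * z).
Proof. by elim: j => //= j <-; rewrite [RHS]opA. Qed.

(* With [F = L_x L_y], the condition [F^m t_{j+2} \in Li] forces
   [F^(m+1) t_j \in Li], because [F t_j = t_{j+2} * t_{j+2}]. *)
Lemma Li_iter_tseq x y k : Li (tseq x y k) ->
  exists m, Li (iter m (fun z => x * (y * z)) x) \/
            Li (iter m (fun z => x * (y * z)) y).
Proof.
set F := fun z => x * (y * z).
have FM m z w : iter m F (z * w) = iter m F z * iter m F w.
  by elim: m => //= m ->; rewrite /F [y * _]opA opA.
suff H m j : Li (iter m F (tseq x y j)) -> exists m',
    Li (iter m' F x) \/ Li (iter m' F y).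
  by move=> Lk; apply: (H 0 k).
move: m; elim/ltn_ind: j => -[|[|j]] IH m; first by exists m; right.
  by exists m; left.
move=> L2; apply: (IH j _ m.+1); first by rewrite ltnS leqnSn.
rewrite iterSr {2}/F -(tseq_step2 x y j) opA FM.
exact/LiM.
Qed.

Lemma crit_le_refl x : x <=c x.
Proof.
have [k /Li_iter_tseq[m]] := permutative_tseq perm x x.
have -> : iter m (fun z => x * (x * z)) x = x ^[m.*2] * x.
  by elim: m => //= m ->.
by case=> ?; exists m.*2.
Qed.

Lemma crit_le_trans x y z : x <=c y -> y <=c z -> x <=c z.
Proof.
move=> [k Lk] [l Ll]; exists k.
by have := Li_iter x _ k Ll; rewrite iter_op_iter iter_Li.
Qed.

Lemma crit_le_opl x y z : y <=c z -> x * y <=c x * z.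
Proof.
move=> [k Lk]; exists k.
by have := LiM x _ Lk; rewrite op_iter.
Qed.

Lemma crit_le_iterl x y z k : y <=c z -> x ^[k] * y <=c x ^[k] * z.
Proof. by move=> yz; elim: k => //= k; exact: crit_le_opl. Qed.

Lemma crit_le_Li x y : Li y -> x <=c y.
Proof. by exists 0. Qed.

Lemma Li_crit_le x y : Li x -> x <=c y -> Li y.
Proof. by move=> Lx [k]; rewrite iter_Li. Qed.

Lemma crit_le_opr x y : x <=c x * y -> x <=c y.
Proof. by move=> [k]; rewrite -iterSr; exists k.+1. Qed.

(** If [y^m * y] is in [Li], so is [y^m * (x * y)], which therefore drops out of the hypothesis once
    [y^m] is applied. *)
Lemma crit_le_of_op_l x y : x * y <=c x -> y <=c x.
Proof.
move=> [k Lk]; have [m Lm] := crit_le_refl y; exists m.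
have := Li_iter y _ m Lk; rewrite iter_op_iter iter_opM.
by rewrite iter_Li //; exact: LiM.
Qed.

(** Consecutive terms of the sequence are comparable where it meets [Li], and comparability descends
    from each pair to the preceding one. *)
Lemma crit_le_total x y : x <=c y \/ y <=c x.
Proof.
have [k] := permutative_tseq perm x y.
have base j : Li (tseq x y j) ->
    tseq x y j.+1 <=c tseq x y j \/ tseq x y j <=c tseq x y j.+1.
  by move=> ?; left; exact: crit_le_Li.
move/base; elim: k => //= k IH [h|h]; apply: IH.
  by right; apply: crit_le_of_op_l.
by left; apply: crit_le_opr.
Qed.

(* For large [k], [(x * y)^k y = (x * y)^k (x * y) = x * (y^k y)]. *)
Lemma op_crit_le x y : x * y <=c x -> x * y <=c y.
Proof.
move=> [k Lk]; have [l Ll] := crit_le_refl y.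
have {}Lk := Li_iter_le _ _ _ _ (leq_maxl k l) Lk.
have {}Ll := Li_iter_le _ _ _ _ (leq_maxr k l) Ll.
exists (maxn k l); move: (maxn k l) Lk Ll => {k l} k Lk Ll.
have <- : (x * y) ^[k] * (x * y) = (x * y) ^[k] * y.
  by rewrite iter_opM Lk.
by rewrite -op_iter; exact: LiM.
Qed.

Lemma op_crit_le_lt x y : ~ x <=c y -> x * y <=c y.
Proof.
move=> nxy; apply: op_crit_le.
by case: (crit_le_total (x * y) x) => // /crit_le_opr.
Qed.

Lemma iter_op_crit_le_lt x y k : ~ x <=c y -> x ^[k] * y <=c y.
Proof.
move=> nxy; elim: k => [|k IH /=]; first exact: crit_le_refl.
apply: crit_le_trans IH; apply: op_crit_le_lt => h.
apply: nxy; elim: k h => [//|k IH /=] /crit_le_opr; exact: IH.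
Qed.

(** Monotonicity turns [x^(k+1) * y] in [Li] into [x^k * y] in [Li]. Hence [x] strictly raises every
    non-maximal critical point from [crit x] on. *)
Lemma Li_of_op_crit_le x y : x <=c y -> x * y <=c y -> Li y.
Proof.
move=> [k Lk] h; elim: k Lk => [//|k IH] Lk; apply: IH.
by apply: Li_crit_le Lk _; rewrite iterSr; exact: crit_le_iterl.
Qed.

(** Both [crit x <= crit z] and [crit (x * z) <= crit z] hold, so [z] is in [Li]. *)
Lemma Li_of_fixed x z : x * z = x -> Li x.
Proof.
move=> e; have xz : x <=c z by apply: crit_le_opr; rewrite e; exact: crit_le_refl.
rewrite -e; apply: LiM; apply: Li_of_op_crit_le xz _.
by apply: op_crit_le; rewrite e; exact: crit_le_refl.
Qed.

(* The congruence [x \equiv^{crit d} y], without reference to a representative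
   [r] of the critical point such that [r * r \in Li]. *)
Definition eqv (d x y : T) : Prop := exists m, d ^[m] * x = d ^[m] * y.

Lemma eqv_iter d x y : eqv d x y ->
  exists m, forall l, (m <= l)%N -> d ^[l] * x = d ^[l] * y.
Proof. by move=> [m e]; exists m => l /subnK <-; rewrite !iterD e. Qed.

Lemma eqv_sym d x y : eqv d x y -> eqv d y x.
Proof. by move=> [m e]; exists m. Qed.

Lemma eqv_trans d x y z : eqv d x y -> eqv d y z -> eqv d x z.
Proof.
move=> /eqv_iter[m e] /eqv_iter[n f]; exists (maxn m n).
by rewrite e ?leq_maxl // f ?leq_maxr.
Qed.

Lemma eqv_opl d w x y : eqv d x y -> eqv (w * d) (w * x) (w * y).
Proof.
by move=> [m e]; exists m; rewrite -!op_iter e.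
Qed.

Lemma eqv_opr d w w' v : eqv d w w' -> eqv d (w * v) (w' * v).
Proof. by move=> [m e]; exists m; rewrite !iter_opM e. Qed.

Lemma eqv_le d g x y : d <=c g -> eqv g x y -> eqv d x y.
Proof.
move=> [m Lm] [k e]; exists m.
have := congr1 (iter m (op d)) e.
by rewrite (iter_op_iter d g x) (iter_op_iter d g y) !(iter_Li _ _ _ Lm).
Qed.

Lemma eqv_op_crit a b v : a <=c b -> eqv a v (b * v).
Proof. by move=> [m Lm]; exists m; rewrite iter_opM Lm. Qed.

Lemma eqv_crit_le d x y : eqv d x y -> d <=c x -> d <=c y.
Proof.
move=> /eqv_iter[m e] [k Lk]; exists (maxn k m).
by rewrite -e ?leq_maxr //; apply: Li_iter_le Lk; exact: leq_maxl.
Qed.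

(* If [d = a * a] and [w \equiv^d a * u] with [crit w <= crit a], then [w * v] is
   again congruent to an element of the image of [a]: with [s] the last iterate
   [u^k * u] below [crit a], one has
   [crit d <= crit (a * (u * s)) <= crit ((a * u) * a)]. *)
Lemma eqv_image a w u v : ~ Li a -> w <=c a ->
  eqv (a * a) w (a * u) -> exists u', eqv (a * a) (w * v) (a * u').
Proof.
set d := a * a => nLa wa wau.
have nda : ~ d <=c a.
  by move=> h; apply: nLa; exact: Li_of_op_crit_le (crit_le_refl a) h.
have nau : ~ a <=c u.
  move=> /(crit_le_opl a) dau; apply: nda; apply: crit_le_trans wa.
  exact: eqv_crit_le (eqv_sym _ _ _ wau) dau.
have [s nas aus] : exists2 s, ~ a <=c s & a <=c u * s.
  have [k Lk] := crit_le_refl u.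
  have : a <=c u ^[k] * u by exact: crit_le_Li.
  elim: k {Lk} => [//|k IH] h.
  by have [/IH//|n] := pselect (a <=c u ^[k] * u); exists (u ^[k] * u).
have sa : s <=c a by case: (crit_le_total a s).
have dg : d <=c (a * u) * a.
  apply: crit_le_trans (crit_le_opl _ _ _ sa).
  apply: crit_le_trans (crit_le_opl _ _ _ (op_crit_le_lt _ _ nas)).
  by rewrite -opA; apply: crit_le_opl.
(* As [v] and [a * v] are congruent modulo [crit a], [dg] allows replacing [(a * u) * v] by
   [(a * u) * (a * v) = a * (u * v)]. *)
exists (u * v); apply: eqv_trans (eqv_opr _ _ _ v wau) _.
rewrite opA; apply: eqv_le dg _; apply: eqv_opl.
by apply: eqv_op_crit; exact: crit_le_refl.
Qed.

Lemma finite_crit_max (b : nat -> T) n : (0 < n)%N ->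
  exists2 i, (i < n)%N & forall j, (j < n)%N -> b j <=c b i.
Proof.
elim: n => // -[|n] IH _.
  by exists 0 => // -[|//] _; exact: crit_le_refl.
have [//|i lin hi] := IH; have [h|h] := crit_le_total (b n.+1) (b i).
  exists i; first exact: leqW.
  by move=> j; rewrite ltnS leq_eqVlt => /orP[/eqP->|/hi].
exists n.+1 => // j; rewrite ltnS leq_eqVlt => /orP[/eqP->|/hi hj].
  exact: crit_le_refl.
exact: crit_le_trans hj h.
Qed.

Lemma no_periodic_division (b v : nat -> T) n : (0 < n)%N ->
  (forall j, b j.+1 = b j * v j) -> (forall j, b (j + n)%N = b j) ->
  exists j, Li (b j).
Proof.
move=> n0 bS bn; have [//|nL] := pselect (exists j, Li (b j)).
have {}nL j : ~ Li (b j) by move=> ?; apply: nL; exists j.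
have [i lin imax] := finite_crit_max b n n0.
have {}imax j : b j <=c b i.
  elim/ltn_ind: j => j IH; have [/imax//|nj] := ltnP j n.
  by rewrite -(subnK nj) bn; apply: IH; rewrite ltn_subrL n0 (leq_trans n0).
set a := b i in imax *.
have H j : exists u, eqv (a * a) (b (j.+1 + i)%N) (a * u).
  elim: j => [|j [u hu]]; first by exists (v i); exists 0; rewrite /= add1n bS.
  by rewrite addSn bS; apply: eqv_image hu; [exact: nL | exact: imax].
(* After [n] steps the cycle is back at [a]. With [d = a * a] this gives
   [d^m * a = (d^m * a) * (d^m * u)], so [d^m * a] is in [Li] and [crit d <= crit a]. *)
have [u] := H n.-1; rewrite prednK // addnC bn => -[m].
rewrite -/a iter_opM => /esym/Li_of_fixed Lm.
case: (nL i); apply: (Li_of_op_crit_le a) (crit_le_refl _) _.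
by exists m.
Qed.

(** For [c] in [Li] the map sending [z] to [x * (y * z)] is the identity, so its iterates reach [Li]
    only from [Li]. *)
Lemma Li_circ x y c : (forall z, c * z = x * (y * z)) -> Li c -> Li x \/ Li y.
Proof.
move=> cE Lc; have [k /Li_iter_tseq[m]] := permutative_tseq perm x y.
rewrite (_ : iter m _ = iter m id); last first.
  by congr iter; apply/funext => z; rewrite -cE.
by rewrite !iter_fix.
Qed.

(** * Critical points as classes *)

Lemma crit_eq x y : (crit op x = crit op y) <-> (x <=c y /\ y <=c x).
Proof.
split=> [e|[xy yx]].
  have : crit op y y by split; exact: crit_le_refl.
  by rewrite -e.
apply/seteqP; split=> z [h1 h2]; split; eauto using crit_le_trans.
Qed.

Lemma crit_maxE x : crit op x = crit_max op <-> Li x.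
Proof.
split=> [e|Lx].
  have : crit_max op x by rewrite -e; split; exact: crit_le_refl.
  have [k Lk] := permutative_tseq perm x x.
  by move=> /(_ (tseq x x k)); exact: Li_crit_le.
apply/seteqP; split=> z.
  by move=> [xz _] y; apply: crit_le_Li; exact: Li_crit_le xz.
by move=> h; split=> //; exact: crit_le_Li.
Qed.

Lemma sharp_crit x r : sharp op x (crit op r) = crit op (x * r).
Proof.
apply/seteqP; split=> z.
  move=> [s [rs sr]]; suff -> : crit op (x * s) = crit op (x * r) by [].
  by apply/crit_eq; split; exact: crit_le_opl.
by exists r => //; split; exact: crit_le_refl.
Qed.

Lemma critc_lt_max x : critc_lt op (crit op x) (crit_max op) <-> ~ Li x.
Proof.
split=> [[_ n] /crit_maxE//|n]; split; last by move/crit_maxE.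
have [k Lk] := permutative_tseq perm x x.
by exists x, (tseq x x k); split=> //; [apply/esym/crit_maxE|exact: crit_le_Li].
Qed.

Lemma idem_Li r x : Li (r * r) -> r <=c x -> Li (r * x).
Proof.
move=> Lr [k]; case: k => [|k]; first exact: LiM.
suff -> : r ^[k.+1] * x = r * x by [].
by elim: k => //= k IH; rewrite -[in RHS]IH /= opA Lr.
Qed.

Lemma crit_equivP r x y : Li (r * r) ->
  crit_equiv op (crit op r) x y <-> r * x = r * y.
Proof.
move=> Lr; split=> [|e]; last by exists r.
move=> [s [/crit_eq[sr rs] Ls e]].
have := congr1 (op r) e; rewrite opA [RHS]opA.
by rewrite !(idem_Li _ _ Lr rs).
Qed.

End PermutativeTheory.

(** * Vast inverse systems *)

Lemma circ_tseq (T : Type) (op circ : T -> T -> T) (e x y : T) k :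
  Li op = [set e] -> is_circ op e circ -> Li op (tseq op x y k) ->
  circ x y = tseq op x y k.+1.
Proof.
move=> Le [cE c1]; rewrite Le => tk.
have -> : circ x y = circ (tseq op x y k.+1) (tseq op x y k).
  by elim: k {tk} => // k ->; rewrite cE.
by rewrite tk.
Qed.

Lemma circ_op (T : Type) (op circ : T -> T -> T) (e x y z : T) :
  permutative op -> Li op = [set e] -> is_circ op e circ ->
  op (circ x y) z = op x (op y z).
Proof.
move=> p Le cP; have [k Lk] := permutative_tseq p x y.
by rewrite (circ_tseq _ _ _ _ _ _ _ Le cP Lk) -(tseq_step2 p x y k) Lk.
Qed.

(** Preimages are chosen above level [m] and images are forced below it; the induction on [m] shifts
    the system by one level. *)
Lemma thread_of (X : nat -> Type) (phi : forall n, X n.+1 -> X n) m (w : X m) :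
  (forall n (x : X n), exists y, phi n y = x) ->
  exists2 t, thread phi t & t m = w.
Proof.
elim: m X phi w => [|m IH] X phi w surj.
  pose s n (x : X n) := projT1 (cid (surj n x)).
  exists (nat_rect X w s) => // n /=.
  by rewrite /s; case: cid.
have [t tP tw] := IH (fun n => X n.+1) (fun n => phi n.+1) w (fun n => surj n.+1).
exists (fun n => match n with 0 => phi 0 (t 0) | n'.+1 => t n' end) => //.
by case.
Qed.

Section VastTheory.
Context {X : nat -> Type} {op : forall n, X n -> X n -> X n}.
Context {phi : forall n, X n.+1 -> X n}.
Hypothesis hX : vast op phi.
Local Notation "x * y" := (op _ x y).
Local Notation Li := (Li (op _)).
Local Infix "<=c" := (crit_le (op _)) (at level 70).
Local Notation thread := (thread phi).
Local Notation EE := (EE op phi).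
Local Notation EEplus := (EEplus op phi).

Let perm n : permutative (op n) := vast_permutative hX n.

Lemma phiM n (x y : X n.+1) : phi n (x * y) = phi n x * phi n y.
Proof. exact: (vast_morph hX). Qed.

Lemma phi_tseq n (x y : X n.+1) k :
  phi n (tseq (op n.+1) x y k) = tseq (op n) (phi n x) (phi n y) k.
Proof.
suff [] : phi n (tseq (op n.+1) x y k) = tseq (op n) (phi n x) (phi n y) k /\
  phi n (tseq (op n.+1) x y k.+1) = tseq (op n) (phi n x) (phi n y) k.+1 by [].
by elim: k => // k [h1 h2]; split=> //; rewrite tseqSS phiM h1 h2.
Qed.

Lemma phi_iter_op n (x y : X n.+1) k :
  phi n (iter k (op n.+1 x) y) = iter k (op n (phi n x)) (phi n y).
Proof. by elim: k => //= k <-; rewrite phiM. Qed.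

Lemma exists_Li n (x : X n) : exists e : X n, Li e.
Proof. by have [k] := permutative_tseq (perm n) x x; eexists; eassumption. Qed.

(* Vastness at [(x, e)] with [e \in Li] cannot be witnessed at level [n] itself. *)
Lemma phi_surj n (x : X n) : exists y, phi n y = x.
Proof.
have [e Le] := exists_Li n x.
have [[|k] [x' [y' [<- e' nL]]]] := vast_nontrivial hX x e.
  case: nL; apply: (permutative_ideal (perm n)).
  by rewrite -e' in Le.
elim: k x' {y' e' nL} => [|k IH] x'; first by exists x'.
exact: (IH (phi _ x')).
Qed.

Lemma phi_Li n (x : X n.+1) : Li x -> Li (phi n x).
Proof. by move=> Lx y; have [z <-] := phi_surj n y; rewrite -phiM Lx. Qed.

(** If [phi x] is in [Li], then [x * x] and [x] have the same image, so [r * x] is idempotent and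
    therefore in [Li]. *)
Lemma kernel_elt n : exists r : X n.+1,
  [/\ alpha op phi (n:=n) = crit (op n.+1) r, Li (r * r),
      forall x, Li (phi n x) <-> r <=c x & Li (phi n r)].
Proof.
have [[r0 _ <-] ker] : kernel_crit op phi (alpha op phi (n:=n)).
  exact: getPex (vast_kernel hX n).
have [r [er Lr _]] : crit_equiv (op n.+1) (crit (op n.+1) r0) r0 r0.
  exact/ker.
move: ker; rewrite -er => ker; exists r.
have LE x : Li (phi n x) <-> r <=c x.
  split=> [L|rx].
    have : phi n (x * x) = phi n x by rewrite phiM L.
    move/ker/(crit_equivP (perm n.+1) _ _ _ Lr).
    rewrite (permutative_LD (perm n.+1)) => /(Li_of_fixed (perm n.+1)) Lrx.
    by exists 1.
  move=> y; have [z <-] := phi_surj n y; rewrite -phiM.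
  apply/ker/(crit_equivP (perm n.+1) _ _ _ Lr).
  by rewrite (permutative_LD (perm n.+1)) (idem_Li (perm n.+1) _ _ Lr rx).
by split=> //; apply/LE; exact: (crit_le_refl (perm n.+1)).
Qed.

(** If [x <=c y] failed, iterating [x] would not raise [crit y], and [crit x <= crit r <= crit (x^k
    * y) <= crit y] would follow. *)
Lemma crit_le_phi n (x y : X n.+1) :
  ~ Li (phi n x) -> phi n x <=c phi n y -> x <=c y.
Proof.
have [r [_ _ rE _]] := kernel_elt n.
move=> nx [k]; rewrite -phi_iter_op => /rE ry.
have [//|nxy] := pselect (x <=c y).
have [xr|/rE//] := crit_le_total (perm n.+1) x r.
apply: (crit_le_trans (perm n.+1)) xr _; apply: (crit_le_trans (perm n.+1)) ry _.
exact: (iter_op_crit_le_lt (perm n.+1)).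
Qed.

Lemma crit_up_Li n (r : X n) : Li r -> crit_up op phi (crit (op n) r) = alpha op phi (n:=n).
Proof.
by move=> /(crit_maxE (perm n)) e; rewrite /crit_up; case: pselect.
Qed.

Lemma crit_up_lift n (r : X n.+1) : ~ Li (phi n r) ->
  crit_up op phi (crit (op n) (phi n r)) = crit (op n.+1) r.
Proof.
move=> nL; rewrite /crit_up; case: pselect => [e|n0] /=.
  by case: nL; apply/(crit_maxE (perm n)).
apply/seteqP; split=> z /=.
  move=> [y /(crit_eq (perm n))[yr ry]].
  suff -> : crit (op n.+1) y = crit (op n.+1) r by [].
  apply/(crit_eq (perm n.+1)); split; apply: crit_le_phi => //.
  by move=> Ly; apply: nL; exact: (Li_crit_le _ _ Ly).
by move=> rz; exists r.
Qed.

(** * Critical points followed through the levels *)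

Let shift := crit_shift op phi.

(** This is the initial segment property in terms of representatives: whatever is trivial at level
    [n] lies above all of [crit[X_n]]. *)
Lemma iter_shift_below n (r0 : X n) k : exists w : X (k + n),
  iter k shift (existT _ n (crit (op n) r0)) = existT _ (k + n)%N (crit (op _) w) /\
  forall r : X (k + n), Li (phi_iter phi r) -> w <=c r.
Proof.
elim: k => [|k [w [e wP]]].
  by exists r0; split=> // r; exact: crit_le_Li.
have [rho [rhoE _ rhoP _]] := kernel_elt (k + n).
rewrite iterS e /shift /crit_shift /=.
have [Lw|nw] := pselect (Li w).
  exists rho; split; first by rewrite crit_up_Li // rhoE.
  by move=> r /wP wr; apply/rhoP; exact: (Li_crit_le _ _ Lw).
have [w' ww'] := phi_surj _ w; exists w'; split.
  by rewrite -ww' crit_up_lift // ww'.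
by move=> r /wP; rewrite -ww' => h; apply: crit_le_phi h; rewrite ww'.
Qed.

Lemma phi_iter_Li n k (x : X (k + n)) : Li x -> Li (phi_iter phi x).
Proof. by elim: k x => //= k IH x /phi_Li; exact: IH. Qed.

Lemma iter_shift_Li n (e : X n) k : Li e -> exists2 v : X (k + n),
  iter k shift (existT _ n (crit (op n) e)) = existT _ (k + n)%N (crit (op _) v) &
  Li (phi_iter phi v).
Proof.
move=> Le; elim: k => [|k [v ve vL]]; first by exists e.
have [rho [rhoE _ _ rhoL]] := kernel_elt (k + n).
rewrite iterS ve /shift /crit_shift /=.
have [Lv|nv] := pselect (Li v).
  exists rho; first by rewrite crit_up_Li // rhoE.
  exact: phi_iter_Li.
by have [v' vv'] := phi_surj _ v; exists v'; rewrite ?vv' // -vv' crit_up_lift // vv'.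
Qed.

Lemma iter_shift_moved (x : forall n, X n) m (w : X m) j :
  thread x -> ~ Li (x m * w) -> exists2 w' : X (j + m),
  iter j shift (existT _ m (crit (op m) w)) = existT _ (j + m)%N (crit (op _) w') &
  ~ Li (x (j + m)%N * w').
Proof.
move=> xP nw; elim: j => [|j [v e nv]]; first by exists w.
have [v' vv'] := phi_surj _ v; exists v'.
  rewrite iterS e /shift /crit_shift /= -vv' crit_up_lift // vv' => Lv.
  by apply: nv; exact: (permutative_ideal (perm _)).
by move=> /phi_Li; rewrite phiM vv' xP.
Qed.

Lemma phi_iter_thread (t : forall n, X n) n k : thread t -> phi_iter phi (t (k + n)%N) = t n.
Proof. by move=> tP; elim: k => //= k IH; rewrite tP. Qed.

Lemma thread_Li_le t m n : thread t -> (m <= n)%N -> Li (t n) -> Li (t m).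
Proof.
move=> tP /subnK <-; rewrite -(phi_iter_thread t m (n - m) tP).
exact: phi_iter_Li.
Qed.

Lemma thread_eq_le t u m n : thread t -> thread u -> (m <= n)%N ->
  t n = u n -> t m = u m.
Proof.
move=> tP uP /subnK <- e.
by rewrite -(phi_iter_thread t m (n - m) tP) e phi_iter_thread.
Qed.

Lemma thread_op t u : thread t -> thread u -> thread (prod_op op t u).
Proof. by move=> tP uP n; rewrite /prod_op phiM tP uP. Qed.

(* A thread [t] with [t n \in Li] has critical point at least [max crit[X_n]]. *)
Lemma EE_E x : EE x <-> thread x /\ forall n, exists t,
  [/\ thread t, Li (t n) & exists m, ~ Li (x m * t m)].
Proof.
split=> -[xP h]; split=> //.
  move=> n; have [e Le] := exists_Li n (x n).
  (* The critical point to test is the greatest one of [X n]; its copies higher up have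
     representatives trivial at level [n]. *)
  have [] := h (crit_same op phi (existT _ n (crit (op n) e))).
    by exists n, (crit (op n) e); split=> //; exists e.
  move=> m [_ [[w _ <-] [i [j]]]].
  rewrite (sharp_crit (perm m)) => same /(critc_lt_max (perm m)) nw.
  have [v vE vL] := iter_shift_Li n e i Le.
  have [w' w'E w'L] := iter_shift_moved x m w j xP nw.
  (* The levels [i + n] and [j + m] agree only through an equality of pairs; quantifying over the
     pair [u] allows rewriting with it. *)
  have {}w'L (u : {n & set (X n)}) : 
      u = existT _ (j + m)%N (crit (op _) w') ->
      forall r : X (projT1 u), projT2 u = crit (op _) r ->
      ~ Li (x (projT1 u) * r).
    move=> -> r /(crit_eq (perm _))[_ rw'] L; apply: w'L.
    exact: (Li_crit_le _ _ L) (crit_le_opl (perm _) _ _ _ rw').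
  have {}w'L := w'L _ (esym (etrans (etrans (esym w'E) (esym same)) vE)) v erefl.
  have [t tP tv] := thread_of X phi _ v phi_surj.
  exists t; split=> //; first by rewrite -(phi_iter_thread t n i tP) tv.
  by exists (i + n)%N; rewrite tv.
move=> _ [n [_ [[r0 _ <-] ->]]].
have [t [tP tn [m nm]]] := h n.
have [mn|/subnK mn] := ltnP m n.
  case: nm; apply: (permutative_ideal (perm m)).
  exact: thread_Li_le (ltnW mn) tn.
move: nm; rewrite -mn; move: (m - n)%N => k {m mn} nm.
have [w [wE wP]] := iter_shift_below n r0 k.
exists (k + n)%N, (crit (op _) w); split; first by exists w.
  by exists k, 0.
rewrite (sharp_crit (perm _)); apply/(critc_lt_max (perm _)) => Lw; apply: nm.
apply: (Li_crit_le _ _ Lw); apply: (crit_le_opl (perm _)); apply: wP.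
by rewrite phi_iter_thread.
Qed.

(** * Closure under the operations *)

Lemma EE_thread x : EE x -> thread x.
Proof. by case. Qed.

(** From level [n] on, [w] lies below the thread [t] given by [EE_E], so [x] cannot make [w] trivial
    without making [t] trivial. *)
Lemma EE_moved x w n : EE x -> thread w -> ~ Li (w n) ->
  exists m, ~ Li (x m * w m).
Proof.
move=> /EE_E[xP /(_ n)[t [tP tn [m nm]]]] wP nw; exists m => L; apply: nm.
have [mn|mn] := ltnP m n.
  apply: (permutative_ideal (perm m)).
  exact: thread_Li_le (ltnW mn) tn.
apply: (Li_crit_le _ _ L); apply: (crit_le_opl (perm _)).
move: mn {L} => /subnK <-; elim: (m - n)%N => [|k IH].
  exact: crit_le_Li.
rewrite addSn; have := IH; rewrite -(tP (k + n)%N) -(wP (k + n)%N).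
apply: crit_le_phi => L; apply: nw; rewrite wP in L.
by apply: thread_Li_le L => //; exact: leq_addl.
Qed.

(** If [y * t] and [x * (y * t)] are nontrivial at some level, then [x * t] serves for [x * y], as
    [x * (y * t) = (x * y) * (x * t)]. *)
Lemma EE_op x y : EE x -> EE y -> EE (prod_op op x y).
Proof.
move=> xE /EE_E[yP hy]; apply/EE_E; have xP := EE_thread x xE.
split; first exact: thread_op.
move=> n; have [t [tP tn [m nm]]] := hy n.
exists (prod_op op x t); split; first exact: thread_op.
  exact: (permutative_ideal (perm n)).
have [k nk] := EE_moved x (prod_op op y t) m xE (thread_op _ _ yP tP) nm.
exists k => L; apply: nk; rewrite /prod_op in L *.
by rewrite (permutative_LD (perm k)).
Qed.

Lemma EEplus_opl x y : EE x -> EEplus y -> EEplus (prod_op op x y).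
Proof.
move=> xE [yE [n yn]]; split; first exact: EE_op.
exact: EE_moved xE (EE_thread y yE) yn.
Qed.

Lemma EEplus_op : closed_under EEplus (prod_op op).
Proof. by move=> x y [xE _]; exact: EEplus_opl. Qed.

Lemma notLi_thread x m n : thread x -> (m <= n)%N -> ~ Li (x m) -> ~ Li (x n).
Proof. by move=> xP mn nm /(thread_Li_le _ _ _ xP mn). Qed.

Lemma vast_thread (t u : forall n, X n) n : thread t -> thread u ->
  exists t' u' m, [/\ thread t', thread u', t' n = t n, u' n = u n
    & ~ Li (t' m * u' m)].
Proof.
move=> tP uP; have [k [x' [y' [xE yE nL]]]] := vast_nontrivial hX (t n) (u n).
have [t' t'P t'E] := thread_of X phi _ x' phi_surj.
have [u' u'P u'E] := thread_of X phi _ y' phi_surj.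
exists t', u', (k + n)%N; split=> //; last by rewrite t'E u'E.
  by rewrite -(phi_iter_thread t' n k) // t'E.
by rewrite -(phi_iter_thread u' n k) // u'E.
Qed.

Section Circ.
Variables (one : forall n, X n) (circ : forall n, X n -> X n -> X n).
Hypothesis Li1 : forall n, Defs.Li (op n) = [set one n].
Hypothesis circP : forall n, is_circ (op n) (one n) (circ n).

Lemma thread_circ x y : thread x -> thread y -> thread (prod_op circ x y).
Proof.
move=> xP yP n; have [k Lk] := permutative_tseq (perm n.+1) (x n.+1) (y n.+1).
rewrite /prod_op (circ_tseq _ _ _ _ _ _ _ (Li1 n.+1) (circP n.+1) Lk).
rewrite phi_tseq xP yP.
rewrite (circ_tseq _ _ _ _ _ _ k (Li1 n) (circP n)) //.
by rewrite -xP -yP -phi_tseq; exact: phi_Li.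
Qed.

(** The [t] for [y] serves again, since [circ x y] acts as [x] after [y]. *)
Lemma EE_circ : closed_under EE (prod_op circ).
Proof.
move=> x y xE /EE_E[yP hy]; apply/EE_E; have xP := EE_thread x xE.
split; first exact: thread_circ.
move=> n; have [t [tP tn [m nm]]] := hy n; exists t; split=> //.
have [k nk] := EE_moved x (prod_op op y t) m xE (thread_op _ _ yP tP) nm.
by exists k; rewrite (circ_op _ _ _ _ _ _ _ (perm k) (Li1 k) (circP k)).
Qed.

Lemma EEplus_circ : closed_under EEplus (prod_op circ).
Proof.
move=> x y [xE [m xm]] [yE [n yn]]; split; first exact: EE_circ.
exists (maxn m n) => L.
have cE z := circ_op _ _ _ _ (x (maxn m n)) (y (maxn m n)) z
  (perm _) (Li1 _) (circP _).
have [] := Li_circ (perm _) _ _ _ cE L.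
  by apply: notLi_thread xm; [exact: EE_thread | exact: leq_maxl].
by apply: notLi_thread yn; [exact: EE_thread | exact: leq_maxr].
Qed.

(** Vastness at [(1, 1)] gives [u] trivial at level [n] with [u' * u], hence also [u = 1 * u],
    outside [Li] higher up. *)
Lemma EE_one : EE one.
Proof.
have oneP : thread one.
  by move=> n; have : Li (phi n (one n.+1)); [apply: phi_Li | ]; rewrite Li1.
apply/EE_E; split=> // n.
have [u' [u [m [_ uP _ un nm]]]] := vast_thread one one n oneP oneP.
exists u; split=> //; first by rewrite un Li1.
exists m => L; apply: nm; apply: (permutative_ideal (perm m)).
by have Lo : Li (one m) by [rewrite Li1]; rewrite -(Lo (u m)).
Qed.

End Circ.

(** * Density *)

(* The limit of threads [t_i] and levels [n_i] such that [t_{i+1}] extends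
   [t_i] beyond level [n_i] and moves a critical point above level [n_i] to one
   visible at level [n_{i+1}]. *)
Lemma EE_extension (t : forall n, X n) n : thread t ->
  exists2 x, EE x & x n = t n.
Proof.
move=> tP.
pose next (p q : (forall n, X n) * nat) := thread p.1 ->
  [/\ thread q.1, (p.2 < q.2)%N, q.1 p.2 = p.1 p.2 & exists e,
    [/\ thread e, Li (e p.2) & ~ Li (q.1 q.2 * e q.2)]].
have nextP p : exists q, next p q.
  have [pP|nP] := pselect (thread p.1); last by exists p.
  have [e0 Le0] := exists_Li p.2 (p.1 p.2).
  have [e eP ee] := thread_of X phi _ e0 phi_surj.
  have [t' [u' [m [t'P u'P t'E u'E nm]]]] := vast_thread p.1 e p.2 pP eP.
  have Lu : Li (u' p.2) by rewrite u'E ee.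
  exists (t', m) => _; split=> //; last by exists u'.
  rewrite ltnNge; apply/negP => mp; apply: nm.
  apply: (permutative_ideal (perm _)); exact: thread_Li_le mp Lu.
have [f fP] := choice nextP.
pose p i := iter i f (t, n).
have pP i : thread (p i).1.
  by elim: i => // i IH; have [] := fP (p i) IH.
have pS i : next (p i) (p i.+1) by exact: fP.
have plt i : ((p i).2 < (p i.+1).2)%N by have [] := pS i (pP i).
have ple i j : (i <= j)%N -> ((p i).2 <= (p j).2)%N.
  by move=> /subnK <-; elim: (j - i)%N => // k IH; apply: leq_trans IH (ltnW (plt _)).
have pge i : (i <= (p i).2)%N.
  by elim: i => // i IH; exact: leq_ltn_trans IH (plt i).
have agree i j k : (i <= j)%N -> (k <= (p i).2)%N -> (p j).1 k = (p i).1 k.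
  move=> /subnK <- ki; elim: (j - i)%N => // d <-; rewrite addSn.
  apply: (thread_eq_le _ _ _ (p (d + i)%N).2) => //.
    by apply: leq_trans ki _; apply: ple; exact: leq_addl.
  by have [] := pS (d + i)%N (pP _).
(* The diagonal works because [k <= (p k).2]: coordinate [k] is final from stage [k] on. *)
pose x k := (p k).1 k.
have xE i k : (k <= (p i).2)%N -> x k = (p i).1 k.
  move=> ki; rewrite /x; have [ik|/ltnW kl] := leqP i k; first exact: agree.
  by rewrite (agree k i).
exists x; last by rewrite (xE 0).
apply/EE_E; split.
  by move=> k; rewrite {1}/x pP -(xE k.+1 k) // ltnW.
move=> k; have [_ _ _ [e [eP Le nm]]] := pS k (pP k).
exists e; split=> //; first exact: thread_Li_le (pge k) Le.
by exists (p k.+1).2; rewrite (xE k.+1).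
Qed.

Lemma EEplus_extension (t : forall n, X n) n : thread t ->
  exists2 x, EEplus x & x n = t n.
Proof.
move=> tP; have [t' [u [m [t'P uP _ un nm]]]] := vast_thread t t n tP tP.
have um : ~ Li (u m).
  by move=> L; apply: nm; exact: (permutative_ideal (perm _)).
have [x xE xm] := EE_extension u (maxn m n) uP.
exists x.
  split=> //; exists m.
  by rewrite (thread_eq_le x u m _ (EE_thread x xE) uP (leq_maxl m n)).
by rewrite -un (thread_eq_le x u n _ (EE_thread x xE) uP (leq_maxr m n)).
Qed.

(** * Acyclicity *)

Lemma prod_op_LD : LD_system (prod_op op).
Proof.
move=> x y z; apply: functional_extensionality_dep => n.
exact: (permutative_LD (perm n)).
Qed.

Lemma EEplus_acyclic : acyclic_on EEplus (prod_op op).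
Proof.
move=> x s; rewrite inE => xE sE s0 cyc.
pose n := size s; pose v j := nth x s (j %% n).
have n0 : (0 < n)%N by rewrite /n; case: s s0 {sE cyc v n}.
have vE j : EEplus (v j).
  by have /(all_nthP x)/(_ _ (ltn_pmod j n0)) := sE; rewrite inE.
pose b := fix b j := if j is j'.+1 then prod_op op (b j') (v j') else x.
have bE j : EEplus (b j) by elim: j => //= j IH; exact: EEplus_op.
have bn : b n = x.
  rewrite -[RHS]cyc; have : (n <= size s)%N by [].
  suff H j : (j <= size s)%N -> b j = foldl (prod_op op) x (take j s).
    by move/H => ->; rewrite take_size.
  elim: j => [|j IH js]; first by rewrite take0.
  rewrite (take_nth x) // -cats1 foldl_cat /= -IH ?(ltnW js) //.
  by rewrite /v modn_small.
have bP j : b (j + n)%N = b j.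
  by elim: j => //= j ->; rewrite /v modnDr.
have [N hN] : exists N, forall j, (j < n)%N -> ~ Li (b j N).
  elim: n {n0 v vE bn bP b bE} (b) (bE) => [|n IH] b bE; first by exists 0.
  have [M hM] := IH b bE; have [bT [K hK]] := bE n.
  exists (maxn M K) => j; rewrite ltnS leq_eqVlt => /orP[/eqP->|jn].
    by apply: notLi_thread hK; [exact: EE_thread | exact: leq_maxr].
  by apply: notLi_thread (hM j jn); [exact/EE_thread/(bE j).1 | exact: leq_maxl].
have [j] := no_periodic_division (perm N) (b^~ N) (v^~ N) n n0
  (fun j => erefl) (fun j => congr1 (fun t : forall n, X n => t N) (bP j)).
elim/ltn_ind: j => j IH; have [/hN//|nj] := ltnP j n.
by rewrite -(subnK nj) bP; apply: IH; rewrite ltn_subrL n0 (leq_trans n0).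
Qed.

End VastTheory.

(** * Comparison of terms *)

Inductive LD_exp : LD_term -> LD_term -> Prop :=
| LDe_refl s : LD_exp s s
| LDe_trans s t u : LD_exp s t -> LD_exp t u -> LD_exp s u
| LDe_app s s' t t' :
    LD_exp s s' -> LD_exp t t' -> LD_exp (LDapp s t) (LDapp s' t')
| LDe_LD s t u :
    LD_exp (LDapp s (LDapp t u)) (LDapp (LDapp s t) (LDapp s u)).

Arguments LDe_trans {s t u}.
Arguments LDe_app {s s' t t'}.

Fixpoint LD_dist (s t : LD_term) : LD_term :=
  match t with
  | LDgen => LDapp s LDgen
  | LDapp t1 t2 => LDapp (LD_dist s t1) (LD_dist s t2)
  end.

(** Dehornoy's operator: all distributions are carried out at once. Its iterates are cofinal among
    the expansions of [t]. *)
Fixpoint LD_full (t : LD_term) : LD_term :=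
  match t with
  | LDgen => LDgen
  | LDapp t1 t2 => LD_dist (LD_full t1) (LD_full t2)
  end.

Lemma LD_exp_congr s t : LD_exp s t -> LD_congr s t.
Proof. by elim=> *; eauto using LD_congr. Qed.

Lemma LD_exp_dist s t : LD_exp (LDapp s t) (LD_dist s t).
Proof.
elim: t => [|t1 IH1 t2 IH2] /=; first exact: LDe_refl.
by apply: LDe_trans (LDe_LD _ _ _) _; exact: LDe_app.
Qed.

Lemma LD_exp_dist_mono s s' t t' :
  LD_exp s s' -> LD_exp t t' -> LD_exp (LD_dist s t) (LD_dist s' t').
Proof.
move=> ss' tt'; apply: (@LDe_trans _ (LD_dist s' t)).
  by elim: t {tt'} => [|t1 IH1 t2 IH2] /=; apply: LDe_app => //; exact: LDe_refl.
elim: tt' => /= *; eauto using LD_exp.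
Qed.

Lemma LD_exp_full t : LD_exp t (LD_full t).
Proof.
elim: t => [|t1 IH1 t2 IH2] /=; first exact: LDe_refl.
by apply: LDe_trans (LDe_app IH1 IH2) (LD_exp_dist _ _).
Qed.

Lemma LD_exp_dist_dist s t u :
  LD_exp (LD_dist s (LD_dist t u)) (LD_dist (LD_dist s t) (LD_dist s u)).
Proof.
elim: u => [|u1 IH1 u2 IH2] /=; last exact: LDe_app.
exact: (LD_exp_dist _ (LDapp s LDgen)).
Qed.

Lemma LD_exp_app_dist s t u :
  LD_exp (LDapp (LD_dist s t) (LD_dist s u)) (LD_dist s (LD_dist t u)).
Proof.
elim: u => [|u1 IH1 u2 IH2] /=; first exact: LDe_refl.
by apply: LDe_trans (LDe_LD _ _ _) _; exact: LDe_app.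
Qed.

Lemma LD_full_mono s t : LD_exp s t -> LD_exp (LD_full s) (LD_full t).
Proof.
elim=> /= [*|*|*|s0 t0 u0]; eauto using LD_exp, LD_exp_dist_mono.
apply: LDe_trans (LD_exp_dist_dist _ _ _) _.
by apply: LD_exp_dist_mono; exact: LDe_refl.
Qed.

Lemma LD_exp_iter_full t m n : (m <= n)%N ->
  LD_exp (iter m LD_full t) (iter n LD_full t).
Proof.
move=> /subnK <-; elim: (n - m)%N => [|k IH]; first exact: LDe_refl.
by apply: LDe_trans IH _; rewrite addSn; exact: LD_exp_full.
Qed.

Lemma iter_LD_full_mono s t n : LD_exp s t ->
  LD_exp (iter n LD_full s) (iter n LD_full t).
Proof. by move=> st; elim: n => //= n; exact: LD_full_mono. Qed.

Lemma iter_LD_full_app s t n :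
  LD_exp (LDapp (iter n LD_full s) (iter n LD_full t))
         (iter n LD_full (LDapp s t)).
Proof.
elim: n => [|n IH]; first exact: LDe_refl.
by apply: LDe_trans (LD_full_mono _ _ IH); exact: LD_exp_dist.
Qed.

(** One application of [LD_full] absorbs a basic expansion; for successive expansions the exponents
    add up, by monotonicity. *)
Lemma LD_exp_iter_full_bound t u : LD_exp t u ->
  exists n, LD_exp u (iter n LD_full t).
Proof.
elim=> [s|{t u} s t u _ [n tn] _ [m um]|{t u} s s' t t' _ [n sn] _ [m tm]|s t' u'].
- by exists 0; exact: LDe_refl.
- exists (m + n)%N; rewrite iterD; apply: LDe_trans um _.
  exact: iter_LD_full_mono.
- exists (maxn n m); apply: LDe_trans (iter_LD_full_app _ _ _); apply: LDe_app.
    by apply: LDe_trans sn (LD_exp_iter_full _ _ _ _); exact: leq_maxl.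
  by apply: LDe_trans tm (LD_exp_iter_full _ _ _ _); exact: leq_maxr.
- exists 1 => /=; apply: LDe_trans (LD_exp_app_dist _ _ _).
  apply: LDe_app; (apply: LDe_trans (LD_exp_dist _ _));
    by apply: LDe_app; exact: LD_exp_full.
Qed.

Lemma LD_exp_confluent t u v : LD_exp t u -> LD_exp t v ->
  exists2 w, LD_exp u w & LD_exp v w.
Proof.
move=> /LD_exp_iter_full_bound[n un] /LD_exp_iter_full_bound[m vm].
exists (iter (maxn n m) LD_full t).
  by apply: LDe_trans un (LD_exp_iter_full _ _ _ _); exact: leq_maxl.
by apply: LDe_trans vm (LD_exp_iter_full _ _ _ _); exact: leq_maxr.
Qed.

Lemma LD_congr_common_exp s t : LD_congr s t ->
  exists2 u, LD_exp s u & LD_exp t u.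
Proof.
elim=> {s t} [s|s t _ [u su tu]|s t u _ [a sa ta] _ [b tb ub]
  |s s' t t' _ [a sa s'a] _ [b tb t'b]|s t u].
- by exists s; exact: LDe_refl.
- by exists u.
- have [c ac bc] := LD_exp_confluent _ _ _ ta tb.
  by exists c; [exact: LDe_trans sa ac | exact: LDe_trans ub bc].
- by exists (LDapp a b); exact: LDe_app.
- by exists (LDapp (LDapp s t) (LDapp s u)); [exact: LDe_LD | exact: LDe_refl].
Qed.

Inductive LD_left (t0 : LD_term) : LD_term -> Prop :=
| LDl_refl : LD_left t0 t0
| LDl_app s t : LD_left t0 s -> LD_left t0 (LDapp s t).

Arguments LDl_app {t0 s}.

(** The left subterm [s] of [s(tu)] survives in [(st)(su)], one step further down the left spine. *)
Lemma LD_left_exp t u t0 : LD_exp t u -> LD_left t0 t ->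
  exists2 t1, LD_left t1 u & LD_exp t0 t1.
Proof.
move=> tu; elim: tu t0 => {t u} [s|s t u _ IH1 _ IH2|s s' t t' ss' IH1 tt' _|s t u] t0.
- by move=> h; exists t0 => //; exact: LDe_refl.
- by move=> /IH1[t1 /IH2[t2 h2 e2] e1]; exists t2 => //; exact: LDe_trans e2.
- move=> h; inversion h as [e|a b h0]; subst.
    by exists (LDapp s' t'); [exact: LDl_refl | exact: LDe_app].
  have [t1 h1 e1] := IH1 _ h0; by exists t1 => //; exact: LDl_app.
- move=> h; inversion h as [e|a b h1]; subst.
    by exists (LDapp (LDapp s t) (LDapp s u)); [exact: LDl_refl | exact: LDe_LD].
  by exists t0; [do 2 apply: LDl_app | exact: LDe_refl].
Qed.

Lemma LD_left_total t1 t2 u : LD_left t1 u -> LD_left t2 u ->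
  LD_left t1 t2 \/ LD_left t2 t1.
Proof.
elim=> [|s t h1 IH] h2; first by right.
inversion h2 as [e|a b h]; subst; first by left; exact: LDl_app.
exact: IH.
Qed.

(** The right power [x^[n+1]]: the index is one less than the exponent. *)
Definition LD_rpow n := iter n (LDapp LDgen) LDgen.

(** For large [n], [(t1 t2) x^[n+1] = (t1 t2)(t1 x^[n]) = t1 (t2 x^[n]) = t1 x^[n+1] = x^[n+2]]. *)
Lemma LD_absorption t : exists N, forall n, (N <= n)%N ->
  LD_congr (LDapp t (LD_rpow n)) (LD_rpow n.+1).
Proof.
elim: t => [|t1 [n1 h1] t2 [n2 h2]]; first by exists 0 => n _; exact: LDc_refl.
exists (maxn n1 n2).+1 => -[//|n]; rewrite ltnS geq_max => /andP[le1 le2].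
apply: (@LDc_trans _ (LDapp (LDapp t1 t2) (LDapp t1 (LD_rpow n)))).
  by apply: LDc_app; [exact: LDc_refl | exact/LDc_sym/h1].
apply: LDc_trans (LDc_sym (LDc_LD _ _ _)) _.
apply: LDc_trans (LDc_app (LDc_refl _) (h2 _ le2)) _.
exact/h1/(leq_trans le1).
Qed.

Definition LD_div (s t : LD_term) : Prop :=
  exists l : seq LD_term, l <> [::] /\ LD_congr (foldl LDapp s l) t.

Definition LD_dive (s t : LD_term) : Prop := LD_congr s t \/ LD_div s t.

Lemma foldl_LDapp_congr s s' l : LD_congr s s' ->
  LD_congr (foldl LDapp s l) (foldl LDapp s' l).
Proof.
elim: l s s' => //= a l IH s s' h.
by apply/IH/LDc_app => //; exact: LDc_refl.
Qed.

Lemma LD_div_congrl s s' t : LD_congr s s' -> LD_div s t -> LD_div s' t.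
Proof.
move=> ss' [l [l0 h]]; exists l; split=> //.
exact: LDc_trans (foldl_LDapp_congr _ _ _ (LDc_sym ss')) h.
Qed.

Lemma LD_div_congrr s t t' : LD_congr t t' -> LD_div s t -> LD_div s t'.
Proof. by move=> tt' [l [l0 h]]; exists l; split=> //; exact: LDc_trans h tt'. Qed.

Lemma LD_div_trans s t u : LD_div s t -> LD_div t u -> LD_div s u.
Proof.
move=> [l [l0 hl]] [m [m0 hm]]; exists (l ++ m); split; first by case: l l0 {hl}.
rewrite foldl_cat; exact: LDc_trans (foldl_LDapp_congr _ _ _ hl) hm.
Qed.

Lemma LD_dive_trans s t u : LD_dive s t -> LD_div t u -> LD_div s u.
Proof.
by case=> [/LDc_sym|]; [exact: LD_div_congrl | exact: LD_div_trans].
Qed.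

Lemma LD_div_app s t : LD_div s (LDapp s t).
Proof. by exists [:: t]; split=> //; exact: LDc_refl. Qed.

Lemma LDapp_foldl a s l :
  LD_congr (LDapp a (foldl LDapp s l)) (foldl LDapp (LDapp a s) (map (LDapp a) l)).
Proof.
elim: l s => [|b l IH] s /=; first exact: LDc_refl.
by apply: LDc_trans (IH _) _; apply/foldl_LDapp_congr/LDc_LD.
Qed.

Lemma LD_div_opl a s t : LD_div s t -> LD_div (LDapp a s) (LDapp a t).
Proof.
move=> [l [l0 h]]; exists (map (LDapp a) l); split; first by case: l l0 {h}.
apply: LDc_trans (LDc_sym (LDapp_foldl _ _ _)) _.
by apply: LDc_app => //; exact: LDc_refl.
Qed.

Lemma LD_left_dive s t : LD_left s t -> LD_dive s t.
Proof.
elim=> [|t1 t2 _ h]; first by left; exact: LDc_refl.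
by right; apply: LD_dive_trans h (LD_div_app _ _).
Qed.

(** Multiplied by a large power of [x], both terms become equivalent to the next power. Up to
    expansion, [s] and [t] then lie on the left spine of a common expansion, which is linearly
    ordered. *)
Lemma LD_comparison s t : LD_congr s t \/ LD_div s t \/ LD_div t s.
Proof.
have [[n hn] [m hm]] := (LD_absorption s, LD_absorption t).
pose N := maxn n m.
have [u su tu] : exists2 u, LD_exp (LDapp s (LD_rpow N)) u &
    LD_exp (LDapp t (LD_rpow N)) u.
  apply: LD_congr_common_exp; apply: LDc_trans (hn N (leq_maxl _ _)) _.
  exact: LDc_sym (hm N (leq_maxr _ _)).
have [s' s'u /LD_exp_congr ss'] := LD_left_exp _ _ _ su (LDl_app _ (LDl_refl s)).
have [t' t'u /LD_exp_congr tt'] := LD_left_exp _ _ _ tu (LDl_app _ (LDl_refl t)).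
have [/LD_left_dive[h|h]|/LD_left_dive[h|h]] := LD_left_total _ _ _ s'u t'u.
- by left; apply: LDc_trans ss' (LDc_trans h (LDc_sym tt')).
- by right; left; apply: LD_div_congrr (LDc_sym tt') (LD_div_congrl _ _ _ (LDc_sym ss') h).
- by left; apply: LDc_trans ss' (LDc_trans (LDc_sym h) (LDc_sym tt')).
- by right; right; apply: LD_div_congrr (LDc_sym ss') (LD_div_congrl _ _ _ (LDc_sym tt') h).
Qed.

(** * Comparison of compositions *)

Fixpoint LD_emb (t : LD_term) : LDm_term :=
  match t with
  | LDgen => LDMgen
  | LDapp s t => LDMapp (LD_emb s) (LD_emb t)
  end.

(* A sequence [a_1, ..., a_n] of terms stands for [a_1 \circ ... \circ a_n]. *)
Definition LDm_comp (p : seq LD_term) : LDm_term :=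
  foldr (fun a => LDMcirc (LD_emb a)) LDMone p.

Definition LD_act (p : seq LD_term) (t : LD_term) : LD_term := foldr LDapp t p.

(** [s * (t * u) = (s o t) * u = ((s * t) o s) * u]. *)
Lemma LDm_congr_LD s t u :
  LDm_congr (LDMapp s (LDMapp t u)) (LDMapp (LDMapp s t) (LDMapp s u)).
Proof.
apply: LDMc_trans (LDMc_sym (LDMc_act _ _ _)) _.
apply: LDMc_trans (LDMc_act _ _ _).
by apply: LDMc_app; [exact: LDMc_comm | exact: LDMc_refl].
Qed.

Lemma LD_emb_congr s t : LD_congr s t -> LDm_congr (LD_emb s) (LD_emb t).
Proof. by elim=> /= *; eauto using LDm_congr, LDm_congr_LD. Qed.

Lemma LDm_comp_cat p q :
  LDm_congr (LDm_comp (p ++ q)) (LDMcirc (LDm_comp p) (LDm_comp q)).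
Proof.
elim: p => [|a p IH] /=; first exact/LDMc_sym/LDMc_1l.
apply: LDMc_trans (LDMc_circ (LDMc_refl _) IH) _; exact: LDMc_assoc.
Qed.

Lemma LD_act_emb p t :
  LDm_congr (LD_emb (LD_act p t)) (LDMapp (LDm_comp p) (LD_emb t)).
Proof.
elim: p => [|a p IH] /=; first exact/LDMc_sym/LDMc_act1.
apply: LDMc_trans (LDMc_app (LDMc_refl _) IH) _.
exact/LDMc_sym/LDMc_act.
Qed.

Lemma LDm_comp_act p q :
  LDm_congr (LDm_comp (map (LD_act p) q)) (LDMapp (LDm_comp p) (LDm_comp q)).
Proof.
elim: q => [|b q IH] /=; first exact/LDMc_sym/LDMc_fix1.
apply: LDMc_trans (LDMc_circ (LD_act_emb _ _) IH) _.
exact/LDMc_sym/LDMc_dist.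
Qed.

Fixpoint LDm_nf (t : LDm_term) : seq LD_term :=
  match t with
  | LDMgen => [:: LDgen]
  | LDMone => [::]
  | LDMapp s t => map (LD_act (LDm_nf s)) (LDm_nf t)
  | LDMcirc s t => LDm_nf s ++ LDm_nf t
  end.

Lemma LDm_nfP t : LDm_congr (LDm_comp (LDm_nf t)) t.
Proof.
elim: t => [||s hs t ht|s hs t ht] /=.
- exact: LDMc_1r.
- exact: LDMc_refl.
- exact: LDMc_trans (LDm_comp_act _ _) (LDMc_app hs ht).
- exact: LDMc_trans (LDm_comp_cat _ _) (LDMc_circ hs ht).
Qed.

(* [LD_cut t p]: for some leaf of the tree [t], [p] lists the subtrees that hang
   to the left of the path from the root to that leaf. *)
Inductive LD_cut : LD_term -> seq LD_term -> Prop :=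
| LDcut_gen : LD_cut LDgen [::]
| LDcut_l s t p : LD_cut s p -> LD_cut (LDapp s t) p
| LDcut_r s t p : LD_cut t p -> LD_cut (LDapp s t) (s :: p).

(** The action is recorded separately because divisibility refers to [LD_congr], while the first
    clause speaks of [LDm_congr]. *)
Definition LD_seq_eqv (p q : seq LD_term) : Prop :=
  LDm_congr (LDm_comp p) (LDm_comp q) /\
  forall t, LD_congr (LD_act p t) (LD_act q t).

Lemma LD_seq_eqv_refl p : LD_seq_eqv p p.
Proof. by split=> [|t]; constructor. Qed.

Lemma LD_seq_eqv_trans p q r :
  LD_seq_eqv p q -> LD_seq_eqv q r -> LD_seq_eqv p r.
Proof.
move=> [h1 k1] [h2 k2]; split=> [|t]; first exact: LDMc_trans h1 h2.
exact: LDc_trans (k1 t) (k2 t).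
Qed.

Lemma LD_seq_eqv_cons a b p q :
  LD_congr a b -> LD_seq_eqv p q -> LD_seq_eqv (a :: p) (b :: q).
Proof.
move=> ab [h k]; split=> [|t] /=; first exact: LDMc_circ (LD_emb_congr _ _ ab) h.
exact: LDc_app.
Qed.

Lemma LD_seq_eqv_comm s t p :
  LD_seq_eqv (s :: t :: p) (LDapp s t :: s :: p).
Proof.
split=> [|u] /=; last exact: LDc_LD.
apply: LDMc_trans (LDMc_assoc _ _ _) _.
apply: LDMc_trans (LDMc_sym (LDMc_assoc _ _ _)).
by apply: LDMc_circ (LDMc_refl _); exact: LDMc_comm.
Qed.

(** A path into [u] passes [s, t] in [s(tu)] and [st, s] in [(st)(su)], where [s o t = (s * t) o s];
    paths into [s] or [t] keep their sequences. *)
Lemma LD_cut_exp t u p : LD_exp t u -> LD_cut t p ->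
  exists2 q, LD_cut u q & LD_seq_eqv p q.
Proof.
move=> tu; elim: tu p => {t u} [s|s t u _ IH1 _ IH2|s s' t t' ss' IH1 tt' IH2|s t u] p.
- by exists p => //; exact: LD_seq_eqv_refl.
- move=> /IH1[q /IH2[r h2 e2] e1]; exists r => //.
  exact: LD_seq_eqv_trans e1 e2.
- move=> h; inversion h as [|a b q h1|a b q h1]; subst.
    have [r hr er] := IH1 _ h1; by exists r => //; exact: LDcut_l.
  have [r hr er] := IH2 _ h1; exists (s' :: r); first exact: LDcut_r.
  by apply: LD_seq_eqv_cons er; exact: LD_exp_congr.
- move=> h; inversion h as [|a b q h1|a b q h1]; subst.
    by exists p; [do 2 apply: LDcut_l | exact: LD_seq_eqv_refl].
  inversion h1 as [|a b r h2|a b r h2]; subst.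
    by exists (s :: q); [apply/LDcut_l/LDcut_r | exact: LD_seq_eqv_refl].
  exists (LDapp s t :: s :: r); first by do 2 apply: LDcut_r.
  exact: LD_seq_eqv_comm.
Qed.

Lemma LD_cut_dive t p : LD_cut t p -> LD_dive (LD_act p LDgen) t.
Proof.
elim=> {t p} [|s t p _ h|s t p _ [h|h]] /=.
- by left; exact: LDc_refl.
- by right; exact: LD_dive_trans h (LD_div_app _ _).
- by left; apply: LDc_app => //; exact: LDc_refl.
- by right; exact: LD_div_opl.
Qed.

(** Where the paths part, one stays inside a subtree [s] that heads the rest of the other sequence:
    its product with [x] equals or divides [s], and [s] divides the other product. *)
Lemma LD_cut_total u p q : LD_cut u p -> LD_cut u q ->
  [\/ LDm_congr (LDm_comp p) (LDm_comp q),
      LD_div (LD_act p LDgen) (LD_act q LDgen) |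
      LD_div (LD_act q LDgen) (LD_act p LDgen)].
Proof.
elim: u p q => [|s IHs t IHt] p q hp hq.
  by inversion hp; inversion hq; apply: Or31; exact: LDMc_refl.
inversion hp as [|a b p' hp'|a b p' hp']; subst;
  inversion hq as [|a b q' hq'|a b q' hq']; subst => /=.
- exact: IHs.
- by apply: Or32; apply: LD_dive_trans (LD_cut_dive _ _ hp') (LD_div_app _ _).
- by apply: Or33; apply: LD_dive_trans (LD_cut_dive _ _ hq') (LD_div_app _ _).
- have [h|h|h] := IHt _ _ hp' hq'.
  + by apply: Or31; apply: LDMc_circ => //; exact: LDMc_refl.
  + by apply: Or32; exact: LD_div_opl.
  + by apply: Or33; exact: LD_div_opl.
Qed.

Lemma LD_cut_act p t : LD_cut t [::] -> LD_cut (LD_act p t) p.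
Proof. by move=> h; elim: p => //= a p; exact: LDcut_r. Qed.

Lemma LD_cut_rpow n : LD_cut (LD_rpow n) [::].
Proof. by case: n => [|n]; [|apply: LDcut_l]; exact: LDcut_gen. Qed.

Lemma LD_act_rpow p : exists N, forall n, (N <= n)%N ->
  LD_congr (LD_act p (LD_rpow n)) (LD_rpow (size p + n)).
Proof.
elim: p => [|a p [N hN]]; first by exists 0 => n _; exact: LDc_refl.
have [M hM] := LD_absorption a; exists (maxn N M) => n.
rewrite geq_max => /andP[Nn Mn] /=.
apply: LDc_trans (LDc_app (LDc_refl _) (hN n Nn)) _; apply: hM.
by apply: leq_trans Mn _; exact: leq_addl.
Qed.

Lemma LDm_comparison p q :
  [\/ LDm_congr (LDm_comp p) (LDm_comp q),
      LD_div (LD_act p LDgen) (LD_act q LDgen) |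
      LD_div (LD_act q LDgen) (LD_act p LDgen)].
Proof.
have [[n hn] [m hm]] := (LD_act_rpow p, LD_act_rpow q).
pose K := maxn n m.
(* Each exponent contains the size of the other sequence, so both terms are equivalent to the same
   power of [x]. *)
have [u pu qu] : exists2 u, LD_exp (LD_act p (LD_rpow (size q + K))) u &
    LD_exp (LD_act q (LD_rpow (size p + K))) u.
  apply: LD_congr_common_exp.
  apply: LDc_trans (hn _ (leq_trans (leq_maxl n m) (leq_addl _ _))) _.
  rewrite addnCA; apply: LDc_sym.
  exact: hm _ (leq_trans (leq_maxr n m) (leq_addl _ _)).
have [p' p'u pp'] := LD_cut_exp _ _ _ pu (LD_cut_act p _ (LD_cut_rpow _)).
have [q' q'u qq'] := LD_cut_exp _ _ _ qu (LD_cut_act q _ (LD_cut_rpow _)).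
have [[pE pA] [qE qA]] := (pp', qq').
have [h|h|h] := LD_cut_total _ _ _ p'u q'u.
- by apply: Or31; exact: LDMc_trans pE (LDMc_trans h (LDMc_sym qE)).
- apply: Or32; apply: LD_div_congrr (LDc_sym (qA _)) _.
  exact: LD_div_congrl (LDc_sym (pA _)) h.
- apply: Or33; apply: LD_div_congrr (LDc_sym (pA _)) _.
  exact: LD_div_congrl (LDc_sym (qA _)) h.
Qed.

(** * Freeness from acyclicity *)

Lemma LD_eval_congr (T : Type) (op : T -> T -> T) (h : LD_term -> T) s t :
  LD_system op -> (forall a b, h (LDapp a b) = op (h a) (h b)) ->
  LD_congr s t -> h s = h t.
Proof. by move=> ld hM; elim=> {s t} *; rewrite ?hM; congruence. Qed.

Lemma LD_eval_div (T : Type) (D : set T) (op : T -> T -> T)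
    (h : LD_term -> T) s t :
  LD_system op -> closed_under D op -> acyclic_on D op ->
  (forall a b, h (LDapp a b) = op (h a) (h b)) -> D (h LDgen) ->
  LD_div s t -> h s <> h t.
Proof.
move=> ld Dop acyc hM Dg [l [l0 /(LD_eval_congr _ _ _ _ _ ld hM) <-]].
have Dh u : D (h u) by elim: u => // a Da b Db; rewrite hM; exact: Dop.
have -> : h (foldl LDapp s l) = foldl op (h s) (map h l).
  by elim: l s {l0} => //= a l IH s; rewrite IH hM.
apply: nesym; apply: acyc; first by rewrite inE.
  by elim: l {l0} => //= a l ->; rewrite andbT inE.
by case: l l0.
Qed.

Lemma acyclic_freely_generates (T : Type) (D : set T) (op : T -> T -> T) x :
  LD_system op -> closed_under D op -> acyclic_on D op -> D x ->
  freely_generates_LD D op x.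
Proof.
move=> ld Dop acyc Dx.
have [f [[fM fx] _]] := free_LD_universal x ld.
pose h s := f (\pi_{eq_quot LD_congr_rel}%qT s).
have hM s t : h (LDapp s t) = op (h s) (h t) by rewrite /h -free_LD_opE fM.
have hx : h LDgen = x by [].
have Dh s : D (h s).
  by elim: s => [|s Ds t Dt]; rewrite ?hx // hM; exact: Dop.
have ndiv s t : LD_div s t -> h s <> h t.
  exact: (LD_eval_div _ D op h).
exists f; split=> //; first by move=> a; have [s ->] := piLD_surj a; exact: Dh.
move=> a b; have [s ->] := piLD_surj a; have [t ->] := piLD_surj b => e.
apply/piLDP; have [//|[/ndiv/(_ e)//|/ndiv]] := LD_comparison s t.
by move/(_ (esym e)).
Qed.

(** Two sets occur because the monoid contains [e], and [e * e = e] is a cycle. If compositions [p]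
    and [q] have equal values, so do [p * x] and [q * x], which excludes strict division in [D]. *)
Lemma acyclic_freely_generates_monoid (T : Type) (D D' : set T)
    (op circ : T -> T -> T) e x :
  LD_system op -> LD_monoid op circ e ->
  closed_under D op -> acyclic_on D op -> D x ->
  closed_under D' op -> closed_under D' circ -> D' e -> D' x ->
  freely_generates_LD_monoid D' op circ e x.
Proof.
move=> ld ldm Dop acyc Dx D'op D'circ D'e D'x.
have [f [[fM fC f1 fx] _]] := free_LDm_universal x ldm.
pose g s := f (\pi_{eq_quot LDm_congr_rel}%qT s).
have gM s t : g (LDMapp s t) = op (g s) (g t).
  by rewrite /g -free_LDm_opE fM.
have gC s t : g (LDMcirc s t) = circ (g s) (g t).
  by rewrite /g -free_LDm_circE fC.
have gx : g LDMgen = x by [].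
have g1 : g LDMone = e by [].
have gE s t : LDm_congr s t -> g s = g t by move/piLDmP => st; rewrite /g st.
have ndiv s t : LD_div s t -> g (LD_emb s) <> g (LD_emb t).
  by apply: (LD_eval_div _ D op (g \o LD_emb)) => //=; rewrite gx.
have actE p : g (LD_emb (LD_act p LDgen)) = op (g (LDm_comp p)) x.
  by rewrite (gE _ _ (LD_act_emb _ _)) gM /= gx.
have D'g s : D' (g s).
  elim: s => [||s Ds t Dt|s Ds t Dt]; rewrite ?gx ?g1 // ?gM ?gC.
    exact: D'op.
  exact: D'circ.
exists f; split=> //; first by move=> a; have [s ->] := piLDm_surj a; exact: D'g.
move=> a b; have [s ->] := piLDm_surj a; have [t ->] := piLDm_surj b => st.
apply/piLDmP; have sE := LDm_nfP s; have tE := LDm_nfP t.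
have {}st : g (LDm_comp (LDm_nf s)) = g (LDm_comp (LDm_nf t)).
  by rewrite (gE _ _ sE) (gE _ _ tE).
have [h|/ndiv h|/ndiv h] := LDm_comparison (LDm_nf s) (LDm_nf t).
- exact: LDMc_trans (LDMc_sym sE) (LDMc_trans h tE).
- by case: h; rewrite !actE st.
- by case: h; rewrite !actE st.
Qed.

Lemma LD_monoid_prod (X : nat -> Type) (op circ : forall n, X n -> X n -> X n)
    (one : forall n, X n) :
  (forall n, LD_monoid (op n) (circ n) (one n)) ->
  LD_monoid (prod_op op) (prod_op circ) one.
Proof.
move=> h; split=> [x y z|x|x|x y z|x y z|x y|x|x];
  apply: functional_extensionality_dep => n.
- exact: LDm_assoc (h n) _ _ _.
- exact: LDm_1l (h n) _.
- exact: LDm_1r (h n) _.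
- exact: LDm_act (h n) _ _ _.
- exact: LDm_dist (h n) _ _ _.
- exact: LDm_comm (h n) _ _.
- exact: LDm_act1 (h n) _.
- exact: LDm_fix1 (h n) _.
Qed.

(** * The inverse limit topology *)

Lemma open_coordinate (X : nat -> choiceType) (P : forall n, set (X n)) :
  @open (prodspace X) [set x | exists n, P n (x n)].
Proof.
rewrite (_ : [set x | _] = \bigcup_n (proj n @^-1` (P n))); last first.
  by apply/seteqP; split=> x /= [n]; [exists n | move=> _; exists n].
apply: bigcup_open => n _.
by apply: open_comp; [move=> x _; exact: proj_continuous | exact: discrete_open].
Qed.

(** The sets of sequences agreeing with [x] up to some [N] generate a filter converging to [x]; as
    the topology is a supremum, this is checked coordinatewise. *)
Lemma open_prodspace (X : nat -> choiceType) (B : set (prodspace X))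
    (x : prodspace X) : open B -> B x ->
  exists N, forall y : prodspace X, (forall n, (n <= N)%N -> y n = x n) -> B y.
Proof.
move=> oB Bx.
pose F := filter_from setT
  (fun N => [set y : prodspace X | forall n, (n <= N)%N -> y n = x n]).
have FF : Filter F.
  apply: filter_from_filter; first by exists 0.
  move=> i j _ _; exists (maxn i j) => // y h; split=> n ni; apply: h.
    exact: leq_trans ni (leq_maxl _ _).
  exact: leq_trans ni (leq_maxr _ _).
suff /(_ B) : F --> x.
  by case=> [|N _ NB]; [exact: open_nbhs_nbhs | exists N].
apply/cvg_sup => n U [V [[W oW <-] Wx] WU].
by exists n => // y h; apply: WU; rewrite /= h.
Qed.

Lemma dense_trace (X : nat -> choiceType) (A B : set (prodspace X)) :
  (forall x N, A x -> exists y, [/\ A y, B y &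
     forall n, (n <= N)%N -> y n = x n]) ->
  dense (trace_on (A := A) B).
Proof.
move=> h O [x Ox] [V oV VO].
have Ax : A (set_val x) by exact: set_valP.
have [|N hN] := open_prodspace _ V (set_val x) oV; first by rewrite -VO in Ox.
have [y [Ay By yx]] := h _ N Ax.
exists (SigSub (mem_set Ay)); split; last by [].
by rewrite -VO; exact: hN.
Qed.

Lemma open_trace (S : topologicalType) (A B : set S) :
  open B -> open (trace_on (A := A) B).
Proof. by move=> oB; exists B. Qed.

Theorem proposition7p9 (X : nat -> choiceType)
    (op : forall n, X n -> X n -> X n) (phi : forall n, X n.+1 -> X n)
    (hX : vast op phi) :
  [/\ [/\ Gdelta (@trace_on (prodspace X) (thread phi) (EE op phi)),
          dense (@trace_on (prodspace X) (thread phi) (EE op phi)),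
          open (@trace_on (prodspace X) (EE op phi) (EEplus op phi))
        & dense (@trace_on (prodspace X) (EE op phi) (EEplus op phi))],
      [/\ closed_under (EE op phi) (prod_op op),
          closed_under (EEplus op phi) (prod_op op)
        & forall (one : forall n, X n) (circ : forall n, X n -> X n -> X n),
            (forall n, Li (op n) = [set one n]) ->
            (forall n, is_circ (op n) (one n) (circ n)) ->
            closed_under (EE op phi) (prod_op circ) /\
            closed_under (EEplus op phi) (prod_op circ)],
      LD_system_on (EEplus op phi) (prod_op op) /\
      acyclic_on (EEplus op phi) (prod_op op)
    & (forall x, EEplus op phi x ->
         freely_generates_LD (EEplus op phi) (prod_op op) x) /\
      (forall (one : forall n, X n) (circ : forall n, X n -> X n -> X n),
         (forall n, permutative_LD_monoid (op n) (circ n) (one n)) ->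
         forall x, (EE op phi `\` [set one]) x ->
           freely_generates_LD_monoid (EE op phi)
             (prod_op op) (prod_op circ) one x)].
Proof.
have EEt x : EE op phi x -> thread phi x by exact: EE_thread.
have EEle x y N : thread phi x -> thread phi y -> y N = x N ->
    forall n, (n <= N)%N -> y n = x n.
  by move=> xP yP yx n nN; exact (thread_eq_le y x n N yP xP nN yx).
have EEpE x : EEplus op phi x -> EE op phi x by case.
have acyc := EEplus_acyclic hX.
have plus_closed := EEplus_op hX.
split; [split|split| |split].
(* By [EE_E], a thread is in [EE] when for each [n] some coordinate [m] lies in [P n m], and for
   fixed [n] this condition is open. *)
- pose P n m := [set z : X m | exists t,
    [/\ thread phi t, Li (op n) (t n) & ~ Li (op m) (op m z (t m))]].
  exists (fun n => trace_on (A := thread phi : set (prodspace X))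
                     [set x | exists m, P n m (x m)]).
    by move=> n; apply: open_trace; exact: (open_coordinate X (P n)).
  apply/seteqP; split=> x.
    move=> /(EE_E hX)[_ h] n _; have [t [tP tn [m nm]]] := h n.
    by exists m, t.
  move=> h; apply/(EE_E hX); split; first exact: set_valP.
  by move=> n; have [m [t [tP tn nm]]] := h n I; exists t; split=> //; exists m.
- apply: dense_trace => x N xP; have [y yE yx] := EE_extension hX x N xP.
  by exists y; split=> //; [exact: EEt | apply: EEle => //; exact: EEt].
- rewrite (_ : trace_on _ = trace_on (A := EE op phi : set (prodspace X))
    [set x | exists n, ~ Li (op n) (x n)]).
    apply: open_trace.
    exact: (open_coordinate X (fun n => [set z | ~ Li (op n) z])).
  apply/seteqP; split=> x; first by case.
  by move=> h; split=> //; exact: set_valP.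
- apply: dense_trace => x N xE.
  have [y yE yx] := EEplus_extension hX x N (EEt x xE).
  have yP := EEt y (EEpE y yE).
  by exists y; split=> //; [exact: EEpE | apply: EEle yx => //; exact: EEt].
- by move=> x y; exact: EE_op.
- exact: plus_closed.
- by move=> one circ Li1 circP; split;
    [exact: (EE_circ hX one) | exact: (EEplus_circ hX one)].
- by split=> //; split=> // x y z _ _ _; exact: prod_op_LD hX x y z.
- move=> x xE; apply: acyclic_freely_generates => //; exact: prod_op_LD hX.
move=> one circ h x [xE /= x1].
have circP n : is_circ (op n) (one n) (circ n).
  by have ldm := pLDm_monoid (h n); split; [exact: LDm_comm ldm | exact: LDm_1r ldm].
have Li1 n := pLDm_reduced (h n).
apply: (acyclic_freely_generates_monoid _ (EEplus op phi)) => //.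
- exact: prod_op_LD hX.
- by apply: LD_monoid_prod => n; exact: pLDm_monoid (h n).
(* As [Li] is [{1}] at each level, a thread other than [one] is nontrivial somewhere. *)
- split=> //; apply/not_existsP => nL; apply: x1.
  apply: functional_extensionality_dep => n.
  by have /contrapT := nL n; rewrite Li1.
- by move=> y z; exact: EE_op.
- exact: (EE_circ hX one).
- exact: (EE_one hX one).
Qed.
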